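(* Let $n=2l+1$ with $l\ge 0$. (Direct problem.) Let $b_0,\dots,b_{n-1}\in\mathbb{R}\setminus\{0\}$ and let $J_n$ be the Schwarz matrix with entries $b_0,\dots,b_{n-1}$. The characteristic polynomial $p(z)=\det(zE_n-J_n)$ is generalized Hurwitz of type I if and only if $$b_0b_1>0,\quad b_2b_3>0,\quad b_4b_5>0,\ \dots,\ b_{n-3}b_{n-2}>0$$ (that is, $b_{2j}b_{2j+1}>0$ for $0\le j\le l-1$). In this case the order $\varkappa$ of $p$ equals the number of negative terms in the sequence $$b_0,\quad b_0b_1b_2,\quad b_0b_1b_2b_3b_4,\ \dots,\ b_0b_1\cdots b_{n-1}$$ (the products $\prod_{k=0}^{2i}b_k$, $i=0,\dots,l$). (Inverse problem.) Conversely, let $\lambda_1,\dots,\lambda_n$ be complex numbers such that the polynomial $p(z)=\prod_{k=1}^n(z-\lambda_k)$ is generalized Hurwitz of type I of order $\varkappa$ and $\Delta_j(p)\ne 0$ for $j=1,\dots,n$. Then there exists a unique Schwarz matrix $J_n$ with nonzero real entries $b_0,\dots,b_{n-1}$ satisfying $b_0b_1>0$, $b_2b_3>0$, $\dots$, $b_{n-3}b_{n-2}>0$, such that the number of negative terms in the sequence $b_0,\ b_0b_1b_2,\ \dots,\ b_0b_1\cdots b_{n-1}$ equals $\varkappa$, and $\sigma(J_n)=\{\lambda_1,\dots,\lambda_n\}$ (spectrum counted with multiplicities).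
   Context: The Schwarz matrix $J_n$ with entries $b_0,\dots,b_{n-1}\in\mathbb{R}\setminus\{0\}$ is the $n\times n$ tridiagonal matrix with $(1,1)$ entry $-b_0$, all other diagonal entries $0$, all superdiagonal entries $1$, and $(k+1,k)$ entry $-b_k$ for $1\le k\le n-1$. $E_n$ is the $n\times n$ identity matrix. Hurwitz determinants: for a monic real polynomial $p(z)=z^n+a_1z^{n-1}+\cdots+a_n$ put $a_0=1$ and $a_i=0$ for $i<0$ or $i>n$; then $\Delta_j(p)=\det\left[a_{2s-r}\right]_{r,s=1}^{j}$ ($r$ the row index, $s$ the column index), $j=1,\dots,n$. $[\alpha]$ is the largest integer not exceeding $\alpha$. Generalized Hurwitz polynomials: a real polynomial $p$ of degree $n$ is generalized Hurwitz of type I of order $\varkappa$, $1\le\varkappa\le\left[\frac{n+1}{2}\right]$, if it has exactly $\varkappa$ zeroes in the closed right half-plane, all of which are nonnegative and simple, $0\le\mu_1<\mu_2<\dots<\mu_\varkappa$, such that: $p(-\mu_i)\ne0$ for $i=2,\dots,\varkappa$, and $p(-\mu_1)\neq 0$ if $\mu_1>0$; $p$ has an odd number of zeroes, counting multiplicities, on each of the intervals $(-\mu_\varkappa,-\mu_{\varkappa-1}),\dots,(-\mu_3,-\mu_2),(-\mu_2,-\mu_1)$; the number of zeroes of $p$ on $(-\mu_1,0)$ (if any) is even, counting multiplicities; the other real zeroes lie on $(-\infty,-\mu_\varkappa)$, an odd number of them counting multiplicities if $n$ is even, and an even number if $n$ is odd; all nonreal zeroes (if any) lie in the open left half-plane.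 A real polynomial is generalized Hurwitz of type I of order $0$ if it is Hurwitz stable, i.e. all its zeroes lie in the open left half-plane. A polynomial is generalized Hurwitz of type I if it is so of some order $\varkappa\ge0$. *)

(* Defs.v *)
From mathcomp Require Import all_boot all_order all_algebra.
From mathcomp Require Import reals complex.

Set Implicit Arguments.
Unset Strict Implicit.
Unset Printing Implicit Defensive.

Import Order.TTheory GRing.Theory Num.Theory.
Local Open Scope ring_scope.
Local Open Scope complex_scope.

(* Indices are 0-based: the entry in row k.+1 and column k of the usual       *)
(* 1-based description, which is - b_k, is found here in row k, column k.-1.  *)
Definition schwarz (R : nzRingType) (n : nat) (b : n.-tuple R) : 'M[R]_n :=
  \matrix_(i, j)
    if (i == 0%N :> nat) && (j == 0%N :> nat) then - b`_0
    else if j == i.+1 :> nat then 1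
    else if i == j.+1 :> nat then - b`_i
    else 0.

Definition schwarz_pairs_pos (R : realDomainType) (l : nat) (b : seq R) : Prop :=
  forall j : nat, (j < l)%N -> 0 < b`_(2 * j) * b`_(2 * j).+1.

Definition schwarz_neg_count (R : realDomainType) (l : nat) (b : seq R) : nat :=
  #|[set i : 'I_l.+1 | \prod_(k < (2 * i).+1) b`_k < 0]|.

(* For p of degree n, a_i is the coefficient of 'X^(n - i), and 0 when i is   *)
(* negative or greater than n.                                                *)
Definition hurwitz_coef (R : nzRingType) (p : {poly R}) (i : int) : R :=
  match i with
  | Posz k => if (k <= (size p).-1)%N then p`_((size p).-1 - k) else 0
  | Negz _ => 0
  end.

(* r and s are 0-based, whence the successors in 2s - r.                      *)
Definition hurwitz_det (R : comNzRingType) (p : {poly R}) (j : nat) : R :=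
  \det (\matrix_(r < j, s < j)
          hurwitz_coef p (2%:Z * (s.+1)%:Z - (r.+1)%:Z)).

(* The complex zeroes of a nonzero real polynomial, repeated according to     *)
(* their multiplicities; the list is meaningful up to permutation.            *)
Definition zeroes (R : rcfType) (p : {poly R}) : seq R[i] :=
  sval (closed_field_poly_normal (map_poly (real_complex R) p)).

Definition spectrum (R : rcfType) (n : nat) (A : 'M[R]_n) : seq R[i] :=
  zeroes (char_poly A).

Definition nb_real_zeroes (R : rcfType) (p : {poly R}) (I : interval R) : nat :=
  count (fun z : R[i] => (complex.Im z == 0) && (complex.Re z \in I)) (zeroes p).

Definition hurwitz_stable (R : rcfType) (p : {poly R}) : Prop :=
  p != 0 /\ {in zeroes p, forall z, complex.Re z < 0}.

(* mu = [:: mu_1; ...; mu_kappa], so that mu`_i is mu_(i + 1).  As mu is      *)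
(* strictly sorted, the equality of multisets in gh1_rhp says that p has      *)
(* exactly kappa zeroes in the closed right half-plane, all of them real and  *)
(* simple, namely the elements of mu.                                         *)
Record gen_hurwitz1_at (R : rcfType) (p : {poly R}) (kappa : nat) (mu : seq R)
    : Prop := GenHurwitz1At {
  gh1_neq0 : p != 0;
  gh1_order : (1 <= kappa <= ((size p).-1 + 1) %/ 2)%N;
  gh1_size : size mu = kappa;
  gh1_sorted : sorted <%R mu;
  gh1_ge0 : 0 <= mu`_0;
  gh1_rhp : perm_eq [seq z <- zeroes p | 0 <= complex.Re z]
                    [seq x%:C | x <- mu];
  gh1_opp : forall i : nat, (0 < i < kappa)%N -> p.[- mu`_i] != 0;
  gh1_opp0 : 0 < mu`_0 -> p.[- mu`_0] != 0;
  gh1_between : forall i : nat, (i.+1 < kappa)%N ->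
    odd (nb_real_zeroes p `](- mu`_i.+1), (- mu`_i)[);
  gh1_near0 : ~~ odd (nb_real_zeroes p `](- mu`_0), 0[);
  gh1_other : forall x : R, root p x -> x \notin mu ->
    (forall i : nat, (i.+1 < kappa)%N ->
       x \notin `](- mu`_i.+1), (- mu`_i)[) ->
    x \notin `](- mu`_0), 0[ ->
    x < - mu`_kappa.-1;
  gh1_far : odd (nb_real_zeroes p `]-oo, (- mu`_kappa.-1)[)
              = ~~ odd (size p).-1;
  gh1_nonreal : {in zeroes p, forall z,
    complex.Im z != 0 -> complex.Re z < 0}
}.

Definition gen_hurwitz1_order (R : rcfType) (p : {poly R}) (kappa : nat) : Prop :=
  if kappa is 0%N then hurwitz_stable p
  else exists mu : seq R, gen_hurwitz1_at p kappa mu.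

Definition gen_hurwitz1 (R : rcfType) (p : {poly R}) : Prop :=
  exists kappa : nat, gen_hurwitz1_order p kappa.

(* Main.v *)
(* The weights pi_k = b_0 ... b_k satisfy Lyapunov's equation                     *)
(* J G + G J^T = - 2 b_0^2 E_00 with G = diag (pi_k), so for row vectors x the    *)
(* form Q(x) = sum_k pi_k |x_k|^2 is nonnegative on the stable invariant subspace *)
(* of J and nonpositive on the antistable one. The row y(z) of trailing minors    *)
(* satisfies y(z) J = z y(z) - p(z) e_0, and for n odd y(-z) is y(z) with its     *)
(* entries multiplied by (-1)^k. A Christoffel-Darboux formula makes the rows     *)
(* y(mu) at real roots orthogonal for the form with weights (-1)^k pi_k, with     *)
(* squares p'(mu) p(-mu) / 2. If the zeroes in the closed right half-plane are    *)
(* simple positive numbers mu with p'(mu) p(-mu) < 0, comparing dimensions gives  *)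
(*   #{k | pi_k < 0} <= kappa <= #{k even | pi_k < 0},                            *)
(* hence pi_k > 0 for odd k, i.e. the pairs are positive; conversely positive     *)
(* pairs force zeroes of this kind. Counting sign changes, this condition on the  *)
(* mu is exactly the type I condition when n is odd and p(0) <> 0.                *)
(* For the inverse problem, one step of Routh's algorithm reduces the Hurwitz     *)
(* matrix of order j + 1 to that of order j.                                      *)

Require Import Defs.
From mathcomp Require Import all_boot all_order all_algebra.
From mathcomp Require Import reals complex.
From mathcomp Require Import ring zify.

Set Implicit Arguments.
Unset Strict Implicit.
Unset Printing Implicit Defensive.

Import Order.TTheory GRing.Theory Num.Theory.
Local Open Scope ring_scope.
Local Open Scope complex_scope.

(** The direct problem goes through an intermediate condition on [p]: its zeroes in the closed right
    half-plane are simple positive numbers m with p'(m) p(-m) < 0. As n is odd and p(0) is nonzero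
    ([schp0_neq0]), counting the real zeroes to the right of m and of -m turns type I into this
    condition ([gen_hurwitz1_order_sign]) and back, given the bound on the order
    ([sign_gen_hurwitz1_order]).

    The condition is then compared with the signs of the weights pi_k. If it holds, two dimension
    counts ([neg_schw_le], [size_le_neg_even_schw]) squeeze the number of such m between the number
    of all negative weights and the number of those of even index. All negative weights thus have
    even index, which makes the pairs positive, and their number is the order ([schwarz_inertia]).
    If conversely the weights of odd index are positive, let z be a zero with nonnegative real part.
    The Darboux identity makes Q negative on y(z), and changing the sign of the odd entries in one
    argument only lowers the value. The orthogonality relation then forces z to be real, and the
    formula for the squares gives the sign ([schwarz_root_rhp]).

    For the inverse problem, [p] splits by parity into q_{N+1} and b_0 q_N, and the three-term
    recursion is the Euclidean algorithm for these two. Nonzero Hurwitz determinants keep every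
    pivot nonzero ([schp_exists]), the leading coefficients determine the entries ([schp_inj]), and
    the direct part supplies the signs and the count. *)

(** * The three-term recursion, parity, and Christoffel-Darboux formulas *)

Section SchwarzPolynomials.
Context {R : comNzRingType}.
Implicit Types c : nat -> R.

(* [schq c k] is the trailing principal minor of order [k] of [zE - J] when    *)
(* [c k = b_(n-1-k)]; only the whole determinant, [schp], sees the entry -b_0. *)
Fixpoint schq c (k : nat) : {poly R} :=
  if k is k1.+1 then
    (if k1 is k2.+1 then 'X * schq c k1 + c k2 *: schq c k2 else 'X)
  else 1.

#[local] Arguments schq : simpl never.

Definition schp c (k : nat) : {poly R} := schq c k.+1 + c k *: schq c k.

Lemma schqSS c k : schq c k.+2 = 'X * schq c k.+1 + c k *: schq c k.
Proof. by []. Qed.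

Lemma eq_schq c c' k : (forall j, (j < k.-1)%N -> c j = c' j) ->
  schq c k = schq c' k.
Proof.
elim/ltn_ind: k => -[|[|k]] IH // cc'; rewrite !schqSS.
rewrite (IH k.+1) ?(IH k) ?cc' // => j lt_jk; apply: cc'; move: lt_jk => /=; lia.
Qed.

Lemma eq_schp c c' k : (forall j, (j <= k)%N -> c j = c' j) ->
  schp c k = schp c' k.
Proof.
move=> cc'; rewrite /schp !(@eq_schq c c') ?cc' // => j lt_jk; apply: cc'.
  by move: lt_jk => /=; lia.
by apply: ltnW.
Qed.

Lemma size_lead_schq c k : (size (schq c k) == k.+1) && (schq c k \is monic).
Proof.
elim/ltn_ind: k => -[|[|k]] IH; first by rewrite size_poly1 monic1 eqxx.
  by rewrite size_polyX monicX eqxx.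
have /andP[/eqP s1 m1] := IH k.+1 (ltnSn _).
have /andP[/eqP s0 m0] := IH k (ltnW (ltnSn _)).
have sX : size ('X * schq c k.+1) = k.+3.
  by rewrite size_monicM ?monicX ?size_polyX ?s1 // monic_neq0.
have lt_s : (size (c k *: schq c k) < size ('X * schq c k.+1)%R)%N.
  by rewrite sX; apply: leq_ltn_trans (size_scale_leq _ _) _; rewrite s0; lia.
by rewrite schqSS size_polyDl // sX eqxx /= monicE lead_coefDl // -monicE monicMl ?monicX.
Qed.

Lemma size_schq c k : size (schq c k) = k.+1.
Proof. by have /andP[/eqP] := size_lead_schq c k. Qed.

Lemma schq_monic c k : schq c k \is monic.
Proof. by have /andP[] := size_lead_schq c k. Qed.

Lemma size_schq_tail c k : (size (c k *: schq c k) < size (schq c k.+1))%N.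
Proof. by apply: leq_ltn_trans (size_scale_leq _ _) _; rewrite !size_schq. Qed.

Lemma size_schp c k : size (schp c k) = k.+2.
Proof. by rewrite size_polyDl ?size_schq_tail // size_schq. Qed.

Lemma schp_monic c k : schp c k \is monic.
Proof. by rewrite monicE lead_coefDl ?size_schq_tail // -monicE schq_monic. Qed.

Lemma schqN c k z : (schq c k).[- z] = (-1) ^+ k * (schq c k).[z].
Proof.
elim/ltn_ind: k => -[|[|k]] IH; first by rewrite !hornerE.
  by rewrite /schq !hornerE expr1 mulN1r.
by rewrite schqSS !hornerE (IH k.+1) ?(IH k) ?(ltnW (ltnSn _)) // !exprS; ring.
Qed.

Lemma schqN_even c k z : ~~ odd k -> (schq c k).[- z] = (schq c k).[z].
Proof. by move=> evk; rewrite schqN -signr_odd (negPf evk) mul1r. Qed.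

Lemma schqN_odd c k z : odd k -> (schq c k).[- z] = - (schq c k).[z].
Proof. by move=> odk; rewrite schqN -signr_odd odk mulN1r. Qed.

Lemma coef_schq_odd c k j : odd (k + j) -> (schq c k)`_j = 0.
Proof.
elim/ltn_ind: k j => -[|[|k]] IH j; first by rewrite coef1; case: j.
  by rewrite coefX; case: j => [|[]].
rewrite schqSS coefD coefXM coefZ => oj; rewrite (IH k) ?mulr0 ?addr0 //.
  case: j oj => // j oj; apply: (IH k.+1) => //.
  by move: oj; rewrite !addSn !addnS /= !negbK.
by move: oj; rewrite /= negbK.
Qed.

(** The two summands of [schp] have opposite parities, so the polynomial determines each of them. *)
Lemma coef_schp c k j :
  (schp c k)`_j = if odd (k + j) then (schq c k.+1)`_j else c k * (schq c k)`_j.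
Proof.
rewrite coefD coefZ; case: ifP => oj.
  by rewrite (@coef_schq_odd c k) // mulr0 addr0.
by rewrite (@coef_schq_odd c k.+1) ?add0r //= oj.
Qed.

(** Christoffel-Darboux with [z + w] in place of the usual [z - w], because of the plus sign in the
    recursion. Passing to [m.+1] multiplies all earlier terms by [c m.+1]. *)
Lemma schq_darboux c m z w :
  (z + w) * \sum_(j < m.+1) (\prod_(j <= i < m.+1) c i) *
                            ((schq c j).[z] * (schq c j).[w])
  = c m * ((schq c m.+1).[z] * (schq c m).[w]
           + (schq c m).[z] * (schq c m.+1).[w]).
Proof.
elim: m => [|m IH].
  by rewrite big_ord_recl big_ord0 /= big_nat1 /schq hornerX hornerX !hornerC; ring.
rewrite big_ord_recr /= big_nat1.
under eq_bigr => j _ do rewrite big_nat_recr /= ?(ltnW (ltn_ord j)) //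
  [_ * c m.+1]mulrC -mulrA.
rewrite -mulr_sumr mulrDr mulrCA IH.
rewrite -/(schq c m.+1) -/(schq c m.+2) schqSS.
by rewrite !(hornerD, hornerM, hornerX, hornerZ); ring.
Qed.

(** The limit of [schq_darboux] as w tends to -z, where its right-hand side vanishes by parity. A
    separate induction avoids dividing by [z + w] in a ring. *)
Lemma schq_darboux_diag c m z :
  \sum_(j < m.+1) (\prod_(j <= i < m.+1) c i) *
                  ((schq c j).[z] * (schq c j).[- z])
  = c m * ((schq c m.+1)^`().[z] * (schq c m).[- z]
           + (schq c m)^`().[z] * (schq c m.+1).[- z]).
Proof.
elim: m => [|m IH].
  by rewrite big_ord_recl big_ord0 /= big_nat1 /schq derivX derivC !hornerC; ring.
rewrite big_ord_recr /= big_nat1.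
under eq_bigr => j _ do rewrite big_nat_recr /= ?(ltnW (ltn_ord j)) //
  [_ * c m.+1]mulrC -mulrA.
rewrite -mulr_sumr IH schqSS derivD derivM derivX derivZ.
by rewrite !(hornerD, hornerM, hornerX, hornerZ, hornerC); ring.
Qed.
End SchwarzPolynomials.
#[local] Arguments schq : simpl never.

Lemma map_schq (R S : comNzRingType) (f : {rmorphism R -> S}) c k :
  map_poly f (schq c k) = schq (f \o c) k.
Proof.
elim/ltn_ind: k => -[|[|k]] IH; first by rewrite rmorph1.
  by rewrite /schq /= map_polyX.
by rewrite !schqSS rmorphD rmorphM /= map_polyX map_polyZ (IH k.+1) ?(IH k).
Qed.

Lemma map_schp (R S : comNzRingType) (f : {rmorphism R -> S}) c k :
  map_poly f (schp c k) = schp (f \o c) k.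
Proof. by rewrite /schp rmorphD /= map_polyZ !map_schq. Qed.

(** * Absence of common zeroes, and recovery of the parameters *)

Section SchwarzPolynomialsField.
Context {F : fieldType}.
Implicit Types c : nat -> F.

(** A common zero of two consecutive polynomials would descend along the recursion to
    [schq c 0 = 1]. *)
Lemma schq_coprime c k z : (forall j, (j < k)%N -> c j != 0) ->
  (schq c k.+1).[z] = 0 -> (schq c k).[z] != 0.
Proof.
elim: k => [|k IH] cn0 q1; first by rewrite hornerE oner_eq0.
apply/eqP => q0; move: q1; rewrite schqSS !hornerE q0 mulr0 add0r.
move/eqP; rewrite mulf_eq0 (negPf (cn0 _ (ltnSn _))) /=; apply/negP/IH => //.
by move=> j /ltnW; apply: cn0.
Qed.

(** The recursion runs backwards: the tail [c k *: schq c k] has leading coefficient [c k], and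
    cancelling it leaves the preceding pair. *)
Lemma schq_inj c c' k : (forall j, (j < k)%N -> c j != 0) ->
  schq c k.+1 = schq c' k.+1 -> schq c k = schq c' k ->
  forall j, (j < k)%N -> c j = c' j.
Proof.
elim: k => // k IH cn0; rewrite !schqSS => + q1; rewrite q1 => /addrI q0.
have ck : c k = c' k.
  have := congr1 lead_coef q0; rewrite !lead_coefZ.
  by rewrite !(monicP (schq_monic _ _)) !mulr1.
rewrite -ck in q0.
move: q0 => /(scalerI (cn0 _ (ltnSn _))) q0.
move=> j; rewrite ltnS leq_eqVlt => /predU1P[->//|]; apply: IH => //.
by move=> i /ltnW; apply: cn0.
Qed.

Lemma schp_inj c c' k : (forall j, (j <= k)%N -> c j != 0) ->
  schp c k = schp c' k -> forall j, (j <= k)%N -> c j = c' j.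
Proof.
move=> cn0 eqp.
have q1 : schq c k.+1 = schq c' k.+1.
  apply/polyP => j; have [oj|oj] := boolP (odd (k + j)).
    by have := congr1 (fun p : {poly F} => p`_j) eqp; rewrite !coef_schp oj.
  by rewrite !coef_schq_odd //= ?oj.
move: eqp; rewrite /schp q1 => /addrI q0.
have ck : c k = c' k.
  have := congr1 lead_coef q0; rewrite !lead_coefZ.
  by rewrite !(monicP (schq_monic _ _)) !mulr1.
rewrite -ck in q0.
move: q0 => /(scalerI (cn0 _ (leqnn _))) q0.
move=> j; rewrite leq_eqVlt => /predU1P[->//|]; apply: schq_inj => //.
by move=> i /ltnW; apply: cn0.
Qed.
End SchwarzPolynomialsField.

(** * The row of trailing minors and the characteristic polynomial *)

Section SchwarzMatrix.
Context {N : nat}.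

Definition rev_entries (R : nzRingType) (b : seq R) : nat -> R :=
  fun k => b`_(N - k).

Lemma map_schwarz (R S : nzRingType) (f : {rmorphism R -> S})
    (b : N.+1.-tuple R) :
  map_mx f (schwarz b) = schwarz (map_tuple f b).
Proof.
apply/matrixP => i j; rewrite !mxE /=.
rewrite !(nth_map 0) ?size_tuple // ?ltn_ord //.
by do ![case: ifP => _]; rewrite ?rmorphN ?rmorph1 ?rmorph0.
Qed.

Section Ring.
Context {R : comNzRingType} (b : N.+1.-tuple R).
Let c := rev_entries b.

Definition schwarz_row (z : R) : 'rV[R]_N.+1 := \row_k (schq c (N - k)).[z].

Lemma mul_schwarz (x : 'rV[R]_N.+1) (k : 'I_N.+1) :
  (x *m schwarz b) 0 k =
  (if k == 0 :> nat then - b`_0 * x 0 0 else x 0 (inord k.-1))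
  - (if (k < N)%N then b`_k.+1 * x 0 (inord k.+1) else 0).
Proof.
rewrite mxE (eq_bigr (fun i : 'I_N.+1 =>
   (if (i == inord k.-1) then (if k == 0 :> nat then - b`_0 * x 0 0 else x 0 i) else 0)
   + (if i == k.+1 :> nat then - b`_i * x 0 i else 0))); last first.
  move=> i _; rewrite mxE -val_eqE /= inordK; last first.
    by case: k => -[|k] //= /ltnW.
  have [k0|k0] := eqVneq (k : nat) 0%N.
    rewrite k0 /= andbT; have [i0|i0] := eqVneq (i : nat) 0%N.
      by rewrite i0 addr0 mulrC; congr (_ * x _ _); apply/val_inj.
    by rewrite add0r; case: ifP => _; rewrite ?mulr0 // mulrC.
  rewrite andbF; have -> : (k == i.+1 :> nat) = (i == k.-1 :> nat).
    by case: (k : nat) k0 => // m _; rewrite eqSS eq_sym.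
  have [ik|ik] := eqVneq (i : nat) k.-1; last first.
    by rewrite add0r; case: ifP => _; rewrite ?mulr0 // mulrC.
  by rewrite mulr1 ik ifN ?addr0 //; case: (k : nat) k0 => // m; lia.
rewrite big_split /= -big_mkcond /= big_pred1_eq; congr (_ + _).
case: ltnP => [lt_kN|le_Nk]; last first.
  rewrite oppr0 big1 // => i _; rewrite ifN //; apply: contraL (ltn_ord i).
  by move/eqP->; rewrite -leqNgt.
rewrite -big_mkcond (big_pred1 (inord k.+1)) ?inordK ?mulNr //.
by move=> i /=; rewrite -val_eqE /= inordK.
Qed.

(** The columns other than the first express the three-term recursion, so the whole defect falls on
    the first one. At a zero of p the row is a left eigenvector. *)
Lemma schwarz_rowE z : schwarz_row z *m schwarz b =
  z *: schwarz_row z - (schp c N).[z] *: delta_mx 0 0.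
Proof.
apply/rowP => k; rewrite mul_schwarz !mxE /= subn0 -val_eqE /=.
have step : (k < N)%N -> z * (schq c (N - k)).[z] =
    (schq c (N - k).+1).[z] - b`_k.+1 * (schq c (N - k.+1)).[z].
  move=> lt_kN; have -> : (N - k)%N = (N - k.+1).+1 by lia.
  rewrite schqSS !(hornerD, hornerM, hornerX, hornerZ) /c /rev_entries.
  by rewrite (_ : N - (N - k.+1) = k.+1)%N ?addrK //; lia.
have last_step : k = N :> nat -> z * (schq c (N - k)).[z] = (schq c (N - k).+1).[z].
  by move=> ->; rewrite subnn /schq hornerX hornerC mulr1.
have [k0|k0] := eqVneq (k : nat) 0%N.
  move: step last_step; rewrite k0 subn0 mulr1 hornerD hornerZ (_ : c N = b`_0).
    2: by rewrite /c /rev_entries subnn.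
  move: (ltn_ord k); rewrite k0 ltnS leq_eqVlt => /orP[/eqP N0|N0].
    by move=> _ /(_ N0) ->; rewrite (_ : (0 < N)%N = false) -?N0 //; ring.
  by move=> /(_ N0) -> _; rewrite N0 inordK //; ring.
rewrite inordK ?mulr0 ?subr0; last by case: (k) k0 => -[|m] //= /ltnW.
have -> : (N - k.-1 = (N - k).+1)%N by have := ltn_ord k; lia.
case: ltnP => [lt_kN|le_Nk]; first by rewrite step // inordK.
by rewrite last_step ?subr0 //; apply/anti_leq; rewrite le_Nk -ltnS ltn_ord.
Qed.
End Ring.

(** The row at the indeterminate satisfies Y (X - J) = p e_0. Multiplying by the adjugate and
    reading the last entry, where Y is 1, shows that p divides the characteristic polynomial; both
    are monic of the same degree. *)
Lemma char_poly_schwarz (R : idomainType) (b : N.+1.-tuple R) :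
  char_poly (schwarz b) = schp (rev_entries b) N.
Proof.
set p := schp _ N.
pose bX := map_tuple polyC b.
pose Y := schwarz_row bX 'X.
have YE : Y *m char_poly_mx (schwarz b) = p *: delta_mx 0 0.
  have revX : rev_entries bX =1 polyC \o rev_entries b.
    by move=> k; rewrite /rev_entries /= (nth_map 0) // size_tuple ltnS leq_subr.
  rewrite /char_poly_mx map_schwarz mulmxBr mul_mx_scalar schwarz_rowE opprB addrC subrK.
  rewrite (@eq_schp _ _ (polyC \o rev_entries b)) // -map_schp.
  by congr (_ *: _); exact: comp_polyXr.
have Yl : Y 0 ord_max = 1 by rewrite mxE subnn /schq hornerC.
have : (char_poly (schwarz b)) = p * (\adj (char_poly_mx (schwarz b)) 0 ord_max).
  have := congr1 (fun M => (M *m \adj (char_poly_mx (schwarz b))) 0 ord_max) YE.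
  rewrite -mulmxA mul_mx_adj mul_mx_scalar mxE Yl mulr1 -/(char_poly _) => ->.
  by rewrite -scalemxAl mxE -rowE mxE.
set a := \adj _ _ _ => E.
have mp : p \is monic := schp_monic _ _.
have la : lead_coef a = 1.
  have := congr1 lead_coef E.
  by rewrite lead_coef_monicM // (monicP (char_poly_monic _)).
have /size_poly1P[d d0 ad] : size a == 1.
  have := congr1 (fun p : {poly R} => size p) E; rewrite size_char_poly.
  rewrite size_monicM //; last by rewrite -lead_coef_eq0 la oner_neq0.
  by rewrite size_schp addSn /= -addn1 => /addnI <-.
by move: la; rewrite E ad lead_coefC => ->; rewrite mulr1.
Qed.

End SchwarzMatrix.

(** * Diagonal Hermitian forms and stable invariant subspaces *)

Section HermitianForm.
Context {C : numClosedFieldType} {N : nat}.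
Local Notation conj := (@Num.conj C).
Implicit Types (x y : 'rV[C]_N.+1) (A : 'M[C]_N.+1) (w : 'I_N.+1 -> C).

Definition hform w x y : C := \sum_k w k * (x 0 k * conj (y 0 k)).

Lemma hformDl w x1 x2 y : hform w (x1 + x2) y = hform w x1 y + hform w x2 y.
Proof. by rewrite -big_split; apply: eq_bigr => k _; rewrite mxE /=; ring. Qed.

Lemma hformDr w x y1 y2 : hform w x (y1 + y2) = hform w x y1 + hform w x y2.
Proof. by rewrite -big_split; apply: eq_bigr => k _; rewrite mxE rmorphD /=; ring. Qed.

Lemma hformZl w a x y : hform w (a *: x) y = a * hform w x y.
Proof. by rewrite mulr_sumr; apply: eq_bigr => k _; rewrite mxE; ring. Qed.

Lemma hformZr w a x y : hform w x (a *: y) = conj a * hform w x y.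
Proof. by rewrite mulr_sumr; apply: eq_bigr => k _; rewrite mxE rmorphM /=; ring. Qed.

Lemma hform_suml w m (a : 'I_m -> C) (x : 'I_m -> 'rV[C]_N.+1) y :
  hform w (\sum_i a i *: x i) y = \sum_i a i * hform w (x i) y.
Proof.
elim/big_rec2: _ => [|i u v _ <-]; last by rewrite hformDl hformZl.
by rewrite -(scale0r 0) hformZl mul0r.
Qed.

Lemma hform_sumr w m (a : 'I_m -> C) x (y : 'I_m -> 'rV[C]_N.+1) :
  hform w x (\sum_i a i *: y i) = \sum_i conj (a i) * hform w x (y i).
Proof.
elim/big_rec2: _ => [|i u v _ <-]; last by rewrite hformDr hformZr.
by rewrite -(scale0r 0) hformZr rmorph0 mul0r.
Qed.

Lemma hformNw w x y : hform (fun k => - w k) x y = - hform w x y.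
Proof. by rewrite -sumrN; apply: eq_bigr => k _; rewrite mulNr. Qed.

(* With x = u (A + conj a) and u in the same invariant subspace, passing from  *)
(* x to u (A - a) (a Blaschke factor) does not increase the form and removes   *)
(* the root [a].                                                               *)
Lemma hform_stable_ge0 w A (s : seq C) x :
  (forall y, hform w (y *m A) y + hform w y (y *m A) <= 0) ->
  {in s, forall a, a + conj a < 0} ->
  x *m horner_mx A (\prod_(a <- s) ('X - a%:P)) = 0 -> 0 <= hform w x x.
Proof.
move=> dissA; elim: s x => [|a s IH] x neg_s.
  by rewrite big_nil rmorph1 mulmx1 => ->; rewrite -(scale0r 0) hformZl mul0r.
set P := \prod_(_ <- _) _ => xP0.
have Pa0 : P.[- conj a] != 0.
  rewrite -rootE root_prod_XsubC; apply/negP => /neg_s.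
  rewrite rmorphN /= conjCK -opprD oppr_lt0 addrC => /lt_trans /(_ (neg_s a _)).
  by rewrite ltxx mem_head => /(_ isT).
(* As P(-conj a) is nonzero, A + conj a is invertible on the kernel of P(A). The quotient [r] gives
   the inverse explicitly, whence [u]. *)
have /factor_theorem[r Pr] : root (P - P.[- conj a]%:P) (- conj a).
  by rewrite rootE !hornerE subrr.
pose u := - (P.[- conj a])^-1 *: (x *m horner_mx A r).
have uP : u *m horner_mx A P = 0.
  rewrite -scalemxAl -mulmxA -[horner_mx A r *m _](comm_horner_mx2 A).
  by rewrite mulmxA xP0 mul0mx scaler0.
have xE : x = u *m A + conj a *: u.
  rewrite -mul_mx_scalar -mulmxDr -scalemxAl -mulmxA.
  have -> : horner_mx A r *m (A + (conj a)%:M) = horner_mx A P - (P.[- conj a])%:M.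
    have := congr1 (horner_mx A) Pr.
    rewrite rmorphM !rmorphB /= horner_mx_X !horner_mx_C => ->.
    by rewrite rmorphN /= opprK.
  by rewrite mulmxBr xP0 sub0r mul_mx_scalar scaleNr scalerN opprK scalerA mulVf ?scale1r.
have /IH y_ge0 : (u *m A - a *: u) *m horner_mx A (\prod_(b <- s) ('X - b%:P)) = 0.
  rewrite -mul_mx_scalar -mulmxBr -mulmxA -uP /P big_cons rmorphM rmorphB /=.
  by rewrite horner_mx_X horner_mx_C.
apply: le_trans (y_ge0 _) _ => [b bs|]; first by apply: neg_s; rewrite inE bs orbT.
(* The squares cancel, and the difference of the two values is (a + conj a) times the dissipation of
   the form at [u], a product of two nonpositive numbers. *)
rewrite -subr_ge0 xE -scaleNr; move: (u) => v.
rewrite !(hformDl, hformDr, hformZl, hformZr).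
rewrite !rmorphN /= conjCK.
have := mulr_le0 (ltW (neg_s a (mem_head _ _))) (dissA v).
by congr (0 <= _); ring.
Qed.
End HermitianForm.

(** * The weights b_0 ... b_k: Lyapunov's equation and Darboux identities *)

Section SchwarzForm.
Context {R : comNzRingType} {N : nat} (b : N.+1.-tuple R).
Let c := @rev_entries N R b.

Definition schw (k : nat) : R := \prod_(i < k.+1) b`_i.

Lemma schw_rev k : (k <= N)%N -> \prod_(N - k <= i < N.+1) c i = schw k.
Proof.
elim: k => [|k IH] lt_kN.
  by rewrite subn0 big_nat1 /schw big_ord1 /c /rev_entries subnn.
rewrite big_ltn; last by lia.
rewrite (_ : (N - k.+1).+1 = N - k)%N; last by lia.
rewrite IH; last exact: ltnW.
rewrite /schw [RHS]big_ord_recr mulrC /=; congr (_ * _).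
by rewrite /c /rev_entries; congr nth; lia.
Qed.

(** Taken without conjugation, so that the polynomial identities apply over any ring; the Hermitian
    form on two rows is its value at z and conj w. *)
Definition schwarz_bil (z w : R) : R :=
  \sum_(k < N.+1) schw k * (schwarz_row b z 0 k * schwarz_row b w 0 k).

Lemma schwarz_bil_rev z w : schwarz_bil z w =
  \sum_(j < N.+1) (\prod_(j <= i < N.+1) c i) * ((schq c j).[z] * (schq c j).[w]).
Proof.
rewrite /schwarz_bil (reindex_inj rev_ord_inj) /=; apply: eq_bigr => j _.
have revE : (N - rev_ord j = j)%N by rewrite /= subSS subKn // -ltnS.
by rewrite !mxE revE -schw_rev ?revE //; apply: (ltn_ord (rev_ord j)).
Qed.

Lemma schwarz_bilE z w : (z + w) * schwarz_bil z w =
  b`_0 * ((schp c N).[z] * (schq c N).[w] + (schq c N).[z] * (schp c N).[w]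
          - 2%:R * b`_0 * (schq c N).[z] * (schq c N).[w]).
Proof.
have cN : c N = b`_0 by rewrite /c /rev_entries subnn.
rewrite schwarz_bil_rev schq_darboux cN; congr (_ * _).
by rewrite /schp !(hornerD, hornerZ) cN; ring.
Qed.

Lemma schwarz_bil_diag z : schwarz_bil z (- z) =
  b`_0 * ((schq c N.+1)^`().[z] * (schq c N).[- z]
          + (schq c N)^`().[z] * (schq c N.+1).[- z]).
Proof.
by rewrite schwarz_bil_rev schq_darboux_diag (_ : c N = b`_0) // /c /rev_entries subnn.
Qed.

(* Lyapunov's equation for the form [schw]: the tridiagonal part is skew.       *)
Lemma schwarz_skew (i j : 'I_N.+1) :
  schwarz b i j * schw j + schw i * schwarz b j i =
  if (i == 0 :> nat) && (j == 0 :> nat) then - (2%:R * b`_0 ^+ 2) else 0.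
Proof.
have schwS k : schw k.+1 = schw k * b`_k.+1 by rewrite /schw big_ord_recr.
rewrite !mxE [(j == 0%N :> nat) && _]andbC; case: ifP => [/andP[/eqP-> /eqP->]|ij].
  by rewrite /schw big_ord1; ring.
have [->|ji] := eqVneq (j : nat) i.+1.
  by rewrite ifN ?schwS; [ring | lia].
have [->|i'j] := eqVneq (i : nat) j.+1; first by rewrite schwS; ring.
by rewrite mul0r mulr0 addr0.
Qed.

Lemma schp_oppr z : ~~ odd N -> (schp c N).[z] = 0 ->
  (schp c N).[- z] = 2%:R * b`_0 * (schq c N).[z].
Proof.
move=> evN /eqP; rewrite /schp !(hornerD, hornerZ) (schqN_even _ _ evN) schqN_odd //.
rewrite addr_eq0 => /eqP ->.
by rewrite /c /rev_entries subnn; ring.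
Qed.

(** For even [N] the row at -z is the row at z with its odd entries negated, so
    [schwarz_bil z (- z)] is the square of the row at z for the weights (-1)^k pi_k. *)
Lemma schwarz_bil_root z : ~~ odd N -> (schp c N).[z] = 0 ->
  2%:R * schwarz_bil z (- z) = (schp c N)^`().[z] * (schp c N).[- z].
Proof.
move=> evN pz; rewrite schwarz_bil_diag schp_oppr // /schp derivD derivZ.
move/eqP: pz; rewrite /schp !(hornerD, hornerZ) (schqN_even _ _ evN) schqN_odd //.
rewrite addr_eq0 => /eqP ->.
by rewrite /c /rev_entries subnn; ring.
Qed.

Lemma schwarz_bil_orth z w : ~~ odd N ->
  (schp c N).[z] = 0 -> (schp c N).[w] = 0 -> (z - w) * schwarz_bil z (- w) = 0.
Proof.
move=> evN pz pw; rewrite schwarz_bilE pz schp_oppr // (schqN_even _ _ evN).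
by ring.
Qed.
End SchwarzForm.

(** * Signs of the weights against zeroes in the right half-plane *)

Section SchwarzInertia.
Context {C : numClosedFieldType} {N : nat} (b : N.+1.-tuple C).
Hypothesis b_real : forall k, b`_k \is Num.real.
Hypothesis b_neq0 : forall k, (k <= N)%N -> b`_k != 0.
Local Notation conj := (@Num.conj C).
Local Notation c := (@rev_entries N C b).
Local Notation A := (schwarz b).
Local Notation p := (schp c N).
Local Notation y := (schwarz_row b).
Local Notation form := (hform (fun k : 'I_N.+1 => schw b k)).

Let cR k : conj (c k) = c k.
Proof. by apply/CrealP/b_real. Qed.

Lemma conj_schq k z : conj (schq c k).[z] = (schq c k).[conj z].
Proof.
rewrite -horner_map map_schq; congr horner.
by apply: eq_schq => j _ /=; rewrite cR.
Qed.

Lemma conj_schp k z : conj (schp c k).[z] = (schp c k).[conj z].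
Proof.
rewrite -horner_map map_schp; congr horner.
by apply: eq_schp => j _ /=; rewrite cR.
Qed.

Lemma form_rowE z w : form (y z) (y w) = schwarz_bil b z (conj w).
Proof. by apply: eq_bigr => k _; rewrite !mxE conj_schq. Qed.

Lemma schw_real k : schw b k \is Num.real.
Proof. by apply: rpred_prod => i _; apply: b_real. Qed.

(** By Lyapunov's equation the left-hand side is -2 b_0^2 |x_0|^2. *)
Lemma form_dissipative x : form (x *m A) x + form x (x *m A) <= 0.
Proof.
have -> : form (x *m A) x + form x (x *m A) =
    \sum_(i < N.+1) \sum_(j < N.+1) x 0 i * conj (x 0 j) *
      (A i j * schw b j + schw b i * A j i).
  rewrite /hform [X in X + _ = _](_ : _ = \sum_k \sum_i x 0 i * conj (x 0 k) *
    (A i k * schw b k)); last first.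
    apply: eq_bigr => k _; rewrite mxE mulr_suml mulr_sumr.
    by apply: eq_bigr => i _; ring.
  rewrite exchange_big /= -big_split /=; apply: eq_bigr => i _.
  rewrite mxE rmorph_sum !mulr_sumr -big_split /=; apply: eq_bigr => j _.
  rewrite rmorphM /=; have -> : conj (A j i) = A j i.
    rewrite mxE; do ![case: ifP => _]; rewrite ?rmorphN ?rmorph0 ?rmorph1 //=;
      by rewrite ?(CrealP (b_real _)).
  by ring.
rewrite (bigD1 ord0) //= (bigD1 ord0) //= !big1 ?addr0.
- rewrite schwarz_skew /= mulrN oppr_le0 mulr_ge0 ?mul_conjC_ge0 //.
  by rewrite mulr_ge0 ?ler0n // real_exprn_even_ge0.
- move=> i i0; rewrite big1 // => j _.
  by rewrite schwarz_skew (negPf (i0 : (i : nat) != 0%N)) mulr0.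
- move=> j j0; rewrite schwarz_skew andbC.
  by rewrite (negPf (j0 : (j : nat) != 0%N)) mulr0.
Qed.

(** Without its last row and first column the matrix is lower triangular, with the superdiagonal
    ones on its diagonal. *)
Lemma mxrank_schwarz_sub (a : C) : (N <= \rank (A - a%:M)%R)%N.
Proof.
pose B := mxsub (lift ord_max) (lift ord0) (A - a%:M) : 'M[C]_N.
have BE : B = rowsub (lift ord_max) 1%:M *m (A - a%:M) *m colsub (lift ord0) 1%:M.
  by rewrite mul_rowsub_mx mul1mx -mxsub_mul mulmx1.
have trigB : is_trig_mx B.
  apply/is_trig_mxP => i j lt_ij; rewrite !mxE -!val_eqE /= /bump /= leqNgt ltn_ord /=.
  rewrite !add0n !add1n andbF ifN; last by rewrite eqSS; lia.
  by rewrite ifN; [rewrite (_ : (i == j.+1 :> nat) = false) ?subr0 //|]; lia.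
have Bu : B \in unitmx.
  rewrite unitmxE det_trig // big1 ?unitr1 // => i _.
  rewrite !mxE -!val_eqE /= /bump /= leqNgt ltn_ord /= !add0n !add1n andbF eqxx.
  by rewrite (_ : (i == i.+1 :> nat) = false) ?subr0 //; lia.
have : (\rank B <= \rank (A - a%:M)%R)%N.
  by rewrite BE; apply: leq_trans (mxrankM_maxl _ _) (mxrankM_maxr _ _).
by rewrite mxrank_unit.
Qed.

Lemma mxrank_schwarz_prod (s : seq C) :
  (N.+1 - size s <= \rank (horner_mx A (\prod_(a <- s) ('X - a%:P))%R))%N.
Proof.
elim: s => [|a s IH]; first by rewrite big_nil rmorph1 mxrank1 subn0.
rewrite big_cons rmorphM rmorphB /= horner_mx_X horner_mx_C.
apply: leq_trans (mxrank_mul_min _ _).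
by apply: leq_trans (leq_sub2r _ (leq_add (mxrank_schwarz_sub a) IH)); lia.
Qed.

(* The form is nonnegative on the kernel of the stable factor of [p] at [J],   *)
(* which has codimension at most [size mu].                                    *)
Lemma neg_schw_le (s mu : seq C) :
  p = \prod_(a <- s) ('X - a%:P) * \prod_(a <- mu) ('X - a%:P) ->
  {in s, forall a, a + conj a < 0} ->
  (#|[set k : 'I_N.+1 | (schw b k < 0)%R]| <= size mu)%N.
Proof.
move=> pE neg_s; set S := [set _ | _]; rewrite leqNgt; apply/negP => lt_mu.
pose F := horner_mx A (\prod_(a <- s) ('X - a%:P)).
have rF : (\rank F <= size mu)%N.
  have /mulmx0_rank_max : F *m horner_mx A (\prod_(a <- mu) ('X - a%:P)) = 0.
    by rewrite -[RHS](Cayley_Hamilton A) char_poly_schwarz pE rmorphM.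
  by move/(leq_trans (leq_add (leqnn _) (mxrank_schwarz_prod mu))); lia.
(* [E] embeds the coordinate subspace of the negative weights. Its dimension exceeds the rank of
   [F], so it contains a nonzero vector killed by [F], on which the form is both negative and
   nonnegative. *)
pose E : 'M[C]_(#|S|, N.+1) := \matrix_(i, j) (j == enum_val i)%:R.
have /rowV0Pn[v /sub_kermxP vEF v0] : kermx (E *m F) != 0.
  rewrite -mxrank_eq0 mxrank_ker -lt0n subn_gt0.
  by apply: leq_ltn_trans (mxrankM_maxr _ _) (leq_ltn_trans rF lt_mu).
have vE k : (v *m E) 0 k = \sum_(i | enum_val i == k) v 0 i.
  rewrite mxE [RHS]big_mkcond; apply: eq_bigr => i _.
  by rewrite mxE eq_sym; case: ifP; rewrite (mulr0, mulr1).
have term_le0 (k : 'I_N.+1) : schw b k * ((v *m E) 0 k * conj ((v *m E) 0 k)) <= 0.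
  have [kS|kS] := boolP (k \in S).
    by rewrite nmulr_rle0 ?mul_conjC_ge0 //; rewrite inE in kS.
  rewrite vE big_pred0 ?mul0r ?mulr0 // => i.
  by apply: contraNF kS => /eqP <-; apply: enum_valP.
have /rV0Pn[i vi0] := v0.
have : 0 <= form (v *m E) (v *m E).
  apply: (@hform_stable_ge0 _ _ _ A s) => //; first exact: form_dissipative.
  by rewrite -mulmxA.
apply/negP; rewrite -real_ltNge ?real0 //; last first.
  by apply: ler0_real; apply: sumr_le0.
rewrite /hform (bigD1 (enum_val i)) //= ltr_wnDr //; first exact: sumr_le0.
have := enum_valP i; rewrite inE => lt0; rewrite nmulr_rlt0 // mul_conjC_gt0.
by rewrite vE (big_pred1 i) // => j; rewrite (inj_eq enum_val_inj).
Qed.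

Lemma eigen_horner (B : 'M[C]_N.+1) (v : 'rV_N.+1) a (q : {poly C}) :
  v *m B = a *: v -> v *m horner_mx B q = q.[a] *: v.
Proof.
move=> vB; elim/poly_ind: q => [|q d IH].
  by rewrite rmorph0 mulmx0 horner0 scale0r.
rewrite rmorphD rmorphM /= horner_mx_X horner_mx_C hornerMXaddC.
by rewrite mulmxDr mulmxA IH mul_mx_scalar -scalemxAl vB scalerA scalerDl.
Qed.

Hypothesis N_even : ~~ odd N.

Lemma schwarz_row_oppr z k : y (- z) 0 k = (-1) ^+ k * y z 0 k.
Proof.
rewrite !mxE schqN -signr_odd oddB ?(negPf N_even) ?signr_odd //.
by rewrite -ltnS ltn_ord.
Qed.

(* On the span of the rows at [mu] the form is nonpositive, and these rows are  *)
(* orthogonal for the form twisted by the signs (-1)^k, with negative squares; *)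
(* so the form is negative definite on the even parts of that span.            *)
Lemma size_le_neg_even_schw (mu : seq C) :
  uniq mu -> {in mu, forall m, [/\ 0 < m, p.[m] = 0 & p^`().[m] * p.[- m] < 0]} ->
  (size mu <= #|[set k : 'I_N.+1 | ~~ odd k & (schw b k < 0)%R]|)%N.
Proof.
move=> uniq_mu mu_root; set S := [set _ | _ & _]; rewrite leqNgt; apply/negP => lt_S.
pose t i := mu`_i; have tP (i : 'I_(size mu)) : t i \in mu by rewrite mem_nth.
have conj_t (i : 'I_(size mu)) : conj (t i) = t i.
  by have [/gtr0_real/CrealP] := mu_root _ (tP i).
(* With fewer indices in [S] than zeroes, some nontrivial combination [x] of the rows vanishes at
   all of [S]. *)
pose M : 'M[C]_(size mu, #|S|) := \matrix_(i, j) y (t i) 0 (enum_val j).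
have /rowV0Pn[a /sub_kermxP aM a0] : kermx M != 0.
  rewrite -mxrank_eq0 mxrank_ker -lt0n subn_gt0.
  by apply: leq_ltn_trans (rank_leq_col _) lt_S.
pose x := \sum_i a 0 i *: y (t i); pose x' := \sum_i a 0 i *: y (- t i).
have x'E k : x' 0 k = (-1) ^+ k * x 0 k.
  rewrite !summxE mulr_sumr; apply: eq_bigr => i _.
  by rewrite [LHS]mxE [in RHS]mxE schwarz_row_oppr mulrCA.
have xx_le0 : form x x <= 0.
  rewrite -oppr_ge0 -hformNw.
  (* The antistable case is the stable one for -A and the opposite form. *)
  apply: (@hform_stable_ge0 _ _ _ (- A) [seq - m | m <- mu]) => [z|m|].
  - rewrite !hformNw mulmxN -!scaleN1r hformZl hformZr rmorphN1.
    by have := form_dissipative z; congr (_ <= 0); ring.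
  - case/mapP=> m' /mu_root[m'_gt0 _ _] ->.
    by rewrite rmorphN /= (CrealP (gtr0_real m'_gt0)) -opprD oppr_lt0 addr_gt0.
  - rewrite mulmx_suml big1 // => i _; rewrite -scalemxAl.
    have [_ pt _] := mu_root _ (tP i).
    rewrite (@eigen_horner _ _ (- t i)).
      rewrite (_ : _.[_] = 0) ?scale0r ?scaler0 //; apply/rootP.
      by rewrite root_prod_XsubC map_f.
    by rewrite mulmxN schwarz_rowE pt scale0r subr0 scaleNr.
have xx'_lt0 : form x x' < 0.
  rewrite hform_suml (eq_bigr (fun i : 'I_(size mu) =>
      a 0 i * conj (a 0 i) * schwarz_bil b (t i) (- t i))); last first.
    move=> i _; rewrite hform_sumr -mulrA; congr (_ * _).
    rewrite (bigD1 i) //= form_rowE rmorphN /= conj_t big1 ?addr0 // => j ji.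
    rewrite form_rowE rmorphN /= conj_t.
    have [[_ pi _] [_ pj _]] := (mu_root _ (tP i), mu_root _ (tP j)).
    have /eqP := schwarz_bil_orth N_even pi pj.
    rewrite mulf_eq0 subr_eq0 nth_uniq // eq_sym (negPf (ji : (j : nat) != i)) /=.
    by move/eqP->; rewrite mulr0.
  have bil_lt0 (i : 'I_(size mu)) : schwarz_bil b (t i) (- t i) < 0.
    have [_ pt ptN] := mu_root _ (tP i).
    by rewrite -(pmulr_rlt0 _ (ltr0n C 2)) schwarz_bil_root.
  have /rV0Pn[i ai0] := a0; rewrite (bigD1 i) //=.
  rewrite ltr_wnDr //; last by rewrite pmulr_rlt0 // mul_conjC_gt0.
  by apply: sumr_le0 => j _; rewrite mulr_ge0_le0 ?mul_conjC_ge0 ?ltW.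
have x_S k : k \in S -> x 0 k = 0.
  move=> kS; have := congr1 (fun M : 'rV_#|S| => M 0 (enum_rank_in kS k)) aM.
  rewrite !mxE => <-; rewrite summxE; apply: eq_bigr => i _.
  by rewrite !mxE enum_rankK_in.
(* [x + x'] is twice the even part of [x]: it vanishes at odd indices and on [S], so only
   nonnegative weights remain. *)
have : 0 <= form (x + x') (x + x').
  apply: sumr_ge0 => k _; rewrite mxE x'E -signr_odd.
  have [od_k|ev_k] := boolP (odd k); first by rewrite mulN1r subrr mul0r mulr0.
  have [lt0|ge0] := real_ltP (schw_real k) (real0 C); last first.
    by rewrite mulr_ge0 ?mul_conjC_ge0.
  by rewrite x_S ?inE ?ev_k // mulr0 addr0 mul0r mulr0.
have -> : form (x + x') (x + x') = 2%:R * (form x x + form x x').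
  rewrite /hform mulrDr !mulr_sumr -[RHS]big_split /=; apply: eq_bigr => k _ /=.
  rewrite mxE x'E !rmorphD /= -signr_odd; case: (odd k).
    by rewrite expr1 !mulN1r rmorphN /=; ring.
  by rewrite expr0 !mul1r; ring.
have lt0 : 2%:R * (form x x + form x x') < 0.
  by rewrite pmulr_rlt0 ?ltr0n // ltr_wnDl.
by move/(lt_le_trans lt0); rewrite ltxx.
Qed.

Lemma schwarz_root_neq0 z : p.[z] = 0 -> (schq c N).[z] != 0.
Proof.
move=> pz; apply/eqP => q0; have q1 : (schq c N.+1).[z] = 0.
  by move: pz; rewrite hornerD hornerZ q0 mulr0 addr0.
have cn0 j : (j < N)%N -> c j != 0 by move=> lt_jN; apply/b_neq0/leq_subr.
by have := schq_coprime cn0 q1; rewrite q0 eqxx.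
Qed.

(** The Darboux identity at w = conj z has the value -2 b_0^2 |q_N(z)|^2 < 0, so Re z > 0 and the
    form is negative on the row at z. Positive odd weights keep the twisted form negative there too;
    since (z - conj z) times its value is 0, z is real. *)
Lemma schwarz_root_rhp z :
  (forall k : nat, (k <= N)%N -> odd k -> 0 < schw b k) ->
  p.[z] = 0 -> 0 <= z + conj z -> 0 < z /\ p^`().[z] * p.[- z] < 0.
Proof.
move=> odd_gt0 pz z_ge0.
have pzc : p.[conj z] = 0 by rewrite -conj_schp pz rmorph0.
have q_neq0 := schwarz_root_neq0 pz.
have : (z + conj z) * form (y z) (y z) < 0.
  rewrite form_rowE schwarz_bilE pz pzc -conj_schq mul0r mulr0 addr0 sub0r.
  rewrite (_ : _ * _ = - (2%:R * (b`_0 ^+ 2 * ((schq c N).[z] * conj (schq c N).[z])))).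
    2: by ring.
  rewrite oppr_lt0 pmulr_rgt0 ?ltr0n // pmulr_rgt0 ?mul_conjC_gt0 //.
  by rewrite real_exprn_even_gt0 //= b_neq0.
have [z0|zn0] := eqVneq (z + conj z) 0; first by rewrite z0 mul0r ltxx.
have z_gt0 : 0 < z + conj z by rewrite lt_def zn0.
rewrite pmulr_rlt0 // => form_lt0.
have bil_le : schwarz_bil b z (- conj z) <= form (y z) (y z).
  rewrite -rmorphN -form_rowE; apply: ler_sum => k _.
  rewrite schwarz_row_oppr rmorphM /= rmorphXn rmorphN1 /= -signr_odd.
  have [od_k|_] := boolP (odd k); last by rewrite expr0 mul1r.
  rewrite expr1 mulN1r !mulrN -subr_ge0 opprK addr_ge0 // mulr_ge0 ?mul_conjC_ge0 //.
    by rewrite ltW // odd_gt0 // -ltnS ltn_ord.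
  by rewrite ltW // odd_gt0 // -ltnS ltn_ord.
have := schwarz_bil_orth N_even pz pzc.
have bil_lt0 := le_lt_trans bil_le form_lt0.
move/eqP; rewrite mulf_eq0 (lt_eqF bil_lt0) orbF subr_eq0 => /eqP zR.
rewrite -zR -mulr2n pmulrn_lgt0 // in z_gt0; split=> //.
by rewrite -schwarz_bil_root // pmulr_rlt0 ?ltr0n // {2}zR.
Qed.
End SchwarzInertia.

(** * Real zeroes and signs of a monic real polynomial *)

Section RealZeroes.
Context {R : rcfType}.
Implicit Types (p : {poly R}) (x : R) (z : R[i]).
Local Notation toC := (real_complex R).
Local Notation Re := complex.Re.
Local Notation Im := complex.Im.

Lemma zeroesE p : p \is monic ->
  map_poly toC p = \prod_(z <- zeroes p) ('X - z%:P).
Proof.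
move=> mp; rewrite /zeroes; case: closed_field_poly_normal => /= s {1}->.
by rewrite lead_coef_map (monicP mp) rmorph1 scale1r.
Qed.

Lemma perm_zeroes p (s : seq R[i]) : p \is monic ->
  map_poly toC p = \prod_(z <- s) ('X - z%:P) -> perm_eq (zeroes p) s.
Proof. by move=> mp ps; apply: prod_XsubC_eq; rewrite -zeroesE. Qed.

Lemma root_zeroes p z : p \is monic -> (z \in zeroes p) = root (map_poly toC p) z.
Proof. by move=> mp; rewrite zeroesE // root_prod_XsubC. Qed.

Lemma real_root_zeroes p x : p \is monic -> (x%:C \in zeroes p) = root p x.
Proof. by move=> mp; rewrite root_zeroes // fmorph_root. Qed.

Lemma size_zeroes p : p \is monic -> size (zeroes p) = (size p).-1.
Proof.
by move=> mp; rewrite -(size_map_poly toC p) zeroesE // size_prod_XsubC.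
Qed.

Lemma zeroes_conj p : p \is monic ->
  perm_eq (zeroes p) [seq conjc z | z <- zeroes p].
Proof.
move=> mp; apply: perm_zeroes => //.
rewrite big_map -(map_prod_XsubC conjc _ _ id) -zeroesE //.
by apply/polyP => k; rewrite !coef_map; apply/esym/conjc_real.
Qed.

Lemma count_zeroes_Im p : p \is monic ->
  count (fun z => Im z < 0) (zeroes p) = count (fun z => 0 < Im z) (zeroes p).
Proof.
move=> mp; rewrite (seq.permP (zeroes_conj mp)) count_map.
by apply: eq_count => -[u v] /=; rewrite oppr_lt0.
Qed.

Lemma odd_nb_real_zeroes p : p \is monic ->
  odd (nb_real_zeroes p `]-oo, +oo[) = odd (size p).-1.
Proof.
move=> mp; rewrite -size_zeroes // -(count_predC (fun z => Im z == 0)).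
rewrite oddD [count (predC _) _](_ : _ = count (fun z => (Im z < 0)%R) (zeroes p)
  + count (fun z => (0 < Im z)%R) (zeroes p))%N.
  rewrite (count_zeroes_Im mp) addnn odd_double addbF; congr odd.
  by apply: eq_count => z /=; rewrite in_itv /= andbT.
rewrite -count_predUI [X in (_ + X)%N](_ : _ = 0)%N ?addn0; last first.
  by rewrite -(count_pred0 (zeroes p)); apply: eq_count => z /=; case: ltgtP.
by apply: eq_count => z /=; rewrite neq_lt.
Qed.

(** Nonreal zeroes come in conjugate pairs; [K] is the squared modulus of the product over those in
    the upper half-plane. *)
Lemma prod_zeroes p x : p \is monic -> exists2 K : R, 0 <= K &
  p.[x] = \prod_(z <- zeroes p | Im z == 0) (x - Re z) * K.
Proof.
move=> mp; have pE := congr1 (fun q : {poly R[i]} => q.[x%:C]) (zeroesE mp).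
rewrite horner_map horner_prod /= (bigID (fun z => Im z == 0)) /= in pE.
rewrite [\prod_(i <- _ | _ != 0) _](bigID (fun z => Im z < 0)) /= in pE.
set P1 := (X in _ = X * _) in pE; set P2 := (X in _ = _ * (X * _)) in pE.
set P3 := (X in _ = _ * (_ * X)) in pE.
have P1E : P1 = (\prod_(z <- zeroes p | Im z == 0) (x - Re z))%:C.
  rewrite rmorph_prod; apply: eq_bigr => -[u v] /= /eqP->.
  by rewrite hornerXsubC; apply/eqP; rewrite eq_complex /= subr0 !eqxx.
have P2E : P2 = conjc P3.
  rewrite rmorph_prod /P2 (perm_big _ (zeroes_conj mp)) big_map /=.
  apply: eq_big => [[u v] /=|[u v] _ /=].
    by rewrite oppr_eq0 oppr_lt0; case: ltgtP.
  by rewrite !hornerXsubC rmorphB; congr (_ - _); apply/esym/conjc_real.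
have /complex_realP[K K_eq] : P2 * P3 \is Num.real.
  by rewrite ger0_real // P2E mulrC mulcJ_ge0.
exists K; last by apply: complexI; rewrite pE P1E K_eq rmorphM.
by rewrite -ler0c -K_eq P2E mulrC mulcJ_ge0.
Qed.

Lemma sg_nb_real_zeroes p x : p \is monic -> p.[x] != 0 ->
  Num.sg p.[x] = (-1) ^+ nb_real_zeroes p `]x, +oo[.
Proof.
move=> mp px0; have [K K_ge0 pxE] := prod_zeroes x mp.
have K_gt0 : 0 < K.
  by rewrite lt_def K_ge0 andbT; apply: contraNneq px0 => K0; rewrite pxE K0 mulr0.
rewrite pxE sgrM (gtr0_sg K_gt0) mulr1 (big_morph _ (@sgrM R) (@sgr1 R)).
rewrite /nb_real_zeroes; have : {in zeroes p, forall z, z != x%:C}.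
  by move=> z; apply: contraTneq => ->; rewrite real_root_zeroes // rootE px0.
elim: (zeroes p) => [|z s IH] z_neq; first by rewrite big_nil.
rewrite big_cons /= exprD -IH; last by move=> t ts; apply: z_neq; rewrite inE ts orbT.
have [Imz|] := eqVneq (Im z) 0; last by rewrite mul1r.
rewrite in_itv andbT /=; congr (_ * _).
have : x - Re z != 0.
  rewrite subr_eq0; apply: contraTneq (z_neq z (mem_head _ _)) => ->.
  by rewrite negbK eq_complex Imz !eqxx.
by case: sgrP => //; rewrite ?subr_gt0 ?subr_lt0 => xz _; rewrite ?(lt_gtF xz) // xz.
Qed.

Lemma nb_real_zeroes_split p x1 x2 : p \is monic -> x1 < x2 -> p.[x2] != 0 ->
  nb_real_zeroes p `]x1, +oo[ =
  (nb_real_zeroes p `]x1, x2[ + nb_real_zeroes p `]x2, +oo[)%N.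
Proof.
move=> mp lt12 px2; rewrite /nb_real_zeroes -count_predUI.
rewrite [X in (_ + X)%N](_ : _ = 0)%N ?addn0; last first.
  rewrite -(count_pred0 (zeroes p)); apply: eq_count => z /=.
  by rewrite !in_itv /= andbT; case: (ltgtP (Re z) x2) => _; rewrite ?andbF.
apply: eq_in_count => z zp /=; rewrite !in_itv /= !andbT -andb_orr.
have [Imz|//] := eqVneq; case: (ltgtP (Re z) x2) => [lt2|lt2|eq2] /=.
- by rewrite andbT orbF.
- by rewrite (lt_trans lt12).
- move: zp; have -> : z = x2%:C by apply/eqP; rewrite eq_complex Imz eq2 !eqxx.
  by rewrite real_root_zeroes // rootE (negPf px2).
Qed.

Lemma odd_nb_real_zeroes_split p x : p \is monic -> p.[x] != 0 ->
  odd (nb_real_zeroes p `]-oo, x[) (+) odd (nb_real_zeroes p `]x, +oo[)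
  = odd (size p).-1.
Proof.
move=> mp px; rewrite -oddD -(odd_nb_real_zeroes mp) /nb_real_zeroes -count_predUI.
rewrite [X in (_ + X)%N](_ : _ = 0)%N ?addn0; last first.
  rewrite -(count_pred0 (zeroes p)); apply: eq_count => z /=.
  by rewrite !in_itv /= andbT; case: (ltgtP (Re z) x) => _; rewrite ?andbF.
congr odd; apply: eq_in_count => z zp /=; rewrite !in_itv /= !andbT -andb_orr.
have [Imz|//] := eqVneq; case: (ltgtP (Re z) x) => // eqx.
move: zp; have -> : z = x%:C by apply/eqP; rewrite eq_complex Imz eqx !eqxx.
by rewrite real_root_zeroes // rootE (negPf px).
Qed.

Lemma deriv_XsubC_mul m (r : {poly R}) : (('X - m%:P) * r)^`().[m] = r.[m].
Proof. by rewrite derivM derivXsubC !hornerE subrr; ring. Qed.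

Lemma monic_root_factor p m : p \is monic -> root p m ->
  exists2 r, r \is monic & p = ('X - m%:P) * r.
Proof.
move=> mp /factor_theorem[r]; rewrite mulrC => pE; exists r => //.
by rewrite -(monicMl _ (monicXsubC m)) -pE.
Qed.

Lemma zeroes_factor (r : {poly R}) m : r \is monic ->
  perm_eq (zeroes (('X - m%:P) * r)) (m%:C :: zeroes r).
Proof.
move=> mr; apply: perm_zeroes; first by rewrite monicMl ?monicXsubC.
by rewrite rmorphM big_cons -zeroesE // rmorphB /= map_polyX map_polyC.
Qed.

Lemma deriv_zeroes_simple p m : p \is monic -> root p m ->
  (p^`().[m] != 0) = (count_mem m%:C (zeroes p) == 1%N).
Proof.
move=> mp /(monic_root_factor mp)[r mr ->]; rewrite deriv_XsubC_mul.
rewrite (seq.permP (zeroes_factor m mr)) /= eqxx add1n eqSS -rootE -real_root_zeroes //.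
by rewrite -[_ == 0%N]negbK -lt0n -has_count has_pred1.
Qed.

(** Writing p = (X - m) r gives p'(m) = r(m), and r has the same zeroes beyond m as p. *)
Lemma sg_deriv_root p m : p \is monic -> root p m -> p^`().[m] != 0 ->
  Num.sg p^`().[m] = (-1) ^+ nb_real_zeroes p `]m, +oo[.
Proof.
move=> mp /(monic_root_factor mp)[r mr ->]; rewrite deriv_XsubC_mul => rm.
rewrite sg_nb_real_zeroes // /nb_real_zeroes.
by rewrite (seq.permP (zeroes_factor m mr)) /= in_itv /= ltxx eqxx.
Qed.
End RealZeroes.

(** * Type I of odd degree as a sign condition at the zeroes in the right half-plane *)

Section GeneralizedHurwitz.
Context {R : rcfType} (p : {poly R}).
Hypotheses (mp : p \is monic) (p_odd : odd (size p).-1) (p0 : p.[0] != 0).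
Local Notation toC := (real_complex R).
Local Notation Re := complex.Re.
Local Notation Im := complex.Im.
Local Notation rhp_zeroes mu :=
  (perm_eq [seq z <- zeroes p | 0 <= Re z] [seq x%:C | x <- mu]).

Lemma nb_real_zeroes_rhp (mu : seq R) x : rhp_zeroes mu -> 0 <= x ->
  nb_real_zeroes p `]x, +oo[ = count (> x) mu.
Proof.
move=> mu_rhp x_ge0; have <- : count (preim toC (fun z => (Im z == 0) && (x < Re z))) mu
    = count (> x) mu by apply: eq_count => t; rewrite /= eqxx.
rewrite -count_map -(seq.permP mu_rhp) count_filter.
apply: eq_count => z /=; rewrite in_itv /= andbT.
case: (ltP x (Re z)) => [lt_x|_]; last by rewrite !andbF.
by rewrite (le_trans x_ge0 (ltW lt_x)) !andbT.
Qed.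

Lemma rhp_root (mu : seq R) m : rhp_zeroes mu -> m \in mu -> root p m /\ 0 < m.
Proof.
move=> mu_rhp m_mu; have : toC m \in [seq z <- zeroes p | 0 <= Re z].
  by rewrite (perm_mem mu_rhp) map_f.
rewrite mem_filter /= real_root_zeroes // => /andP[m_ge0 rm]; split=> //.
by rewrite lt_def m_ge0 andbT; apply: contraNneq p0 => m0; move: rm; rewrite m0.
Qed.

Lemma rhp_simple (mu : seq R) m : rhp_zeroes mu -> uniq mu -> m \in mu ->
  p^`().[m] != 0.
Proof.
move=> mu_rhp mu_uniq m_mu; have [rm m_gt0] := rhp_root mu_rhp m_mu.
rewrite deriv_zeroes_simple // -[X in X == _]addn0.
rewrite (_ : count _ _ = count_mem m%:C [seq z <- zeroes p | 0 <= Re z]); last first.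
  rewrite count_filter; apply: eq_count => z /=.
  by have [->|//] := eqVneq z; rewrite /= ltW.
rewrite (seq.permP mu_rhp) count_uniq_mem ?map_f ?addn0 ?eqxx //.
by rewrite map_inj_uniq //; apply: complexI.
Qed.

Lemma deriv_mul_oppr_lt0 (mu : seq R) i : rhp_zeroes mu -> sorted <%R mu ->
  (i < size mu)%N -> p.[- mu`_i] != 0 ->
  (p^`().[mu`_i] * p.[- mu`_i] < 0) =
  odd (nb_real_zeroes p `](- mu`_i), +oo[ + (size mu - i.+1)).
Proof.
move=> mu_rhp mu_sorted lt_i p_mui; have mui_mu : mu`_i \in mu by apply: mem_nth.
have [root_mui mui_gt0] := rhp_root mu_rhp mui_mu.
have dp_neq0 := rhp_simple mu_rhp (lt_sorted_uniq mu_sorted) mui_mu.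
rewrite -sgr_lt0 sgrM sg_deriv_root // sg_nb_real_zeroes // -exprD.
rewrite (nb_real_zeroes_rhp mu_rhp) ?ltW //.
rewrite (_ : count _ mu = size mu - i.+1)%N; last first.
  rewrite -(count_le_nth 0 mu_sorted lt_i) -(count_predC (<= mu`_i) mu) addKn.
  by apply: eq_count => t /=; rewrite -ltNge.
by rewrite addnC -signr_odd; case: odd; rewrite ?ltrN10 // expr0 ltNge ler01.
Qed.

Lemma gen_hurwitz1_order_sign kappa : gen_hurwitz1_order p kappa ->
  exists mu, [/\ size mu = kappa, uniq mu, rhp_zeroes mu &
    {in mu, forall m, 0 < m /\ p^`().[m] * p.[- m] < 0}].
Proof.
case: kappa => [[_ p_neg]|kappa [mu mu_at]].
  exists nil; split=> //; rewrite (@eq_in_filter _ _ pred0) ?filter_pred0 //.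
  by move=> z /p_neg; rewrite leNgt => ->.
have [_ _ size_mu mu_sorted _ mu_rhp opp opp0 between _ _ far _] := mu_at.
have mu_gt0 i : (i < kappa.+1)%N -> 0 < mu`_i.
  by rewrite -size_mu => /(mem_nth 0)/(rhp_root mu_rhp)[].
have p_oppr i : (i < kappa.+1)%N -> p.[- mu`_i] != 0.
  by case: i => [|i] lt_i; [apply/opp0/mu_gt0 | apply: opp].
(* Induction from the largest element of [mu] downwards. The number of zeroes to the left of its
   opposite is even, which starts it; each gap then removes an odd number of zeroes while one more
   element of [mu] is larger. *)
have parity j : (j <= kappa)%N ->
    odd (nb_real_zeroes p `](- mu`_(kappa - j)), +oo[ + j).
  elim: j => [|j IH] lt_j.
    rewrite subn0 addn0; have := odd_nb_real_zeroes_split mp (p_oppr kappa (ltnSn _)).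
    by rewrite p_odd; move: far; rewrite p_odd /= => ->.
  have := IH (ltnW lt_j); set i := (kappa - j.+1)%N.
  rewrite (_ : kappa - j = i.+1)%N; last by rewrite /i; lia.
  have lt_mu : - mu`_i.+1 < - mu`_i.
    by rewrite ltrN2 (lt_sorted_ltn_nth 0 mu_sorted) ?inE ?size_mu /i //; lia.
  rewrite (nb_real_zeroes_split mp lt_mu); last by apply: p_oppr; rewrite /i; lia.
  rewrite -addnA oddD between; last by rewrite /i; lia.
  by rewrite addnS addTb.
exists mu; split=> //; first exact: lt_sorted_uniq.
move=> m m_mu; have [_ m_gt0] := rhp_root mu_rhp m_mu; split=> //.
have := m_mu; rewrite -index_mem => lt_i; have mE := nth_index 0 m_mu.
rewrite -mE deriv_mul_oppr_lt0 //; last by apply: p_oppr; rewrite -size_mu.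
have := parity (kappa - index m mu)%N (leq_subr _ _).
by rewrite subKn ?size_mu ?subSS //; rewrite size_mu in lt_i.
Qed.

Lemma sign_gen_hurwitz1_order (mu : seq R) :
  uniq mu -> rhp_zeroes mu -> (size mu <= ((size p).-1 + 1) %/ 2)%N ->
  {in mu, forall m, p^`().[m] * p.[- m] < 0} ->
  gen_hurwitz1_order p (size mu).
Proof.
move=> + + size_mu; wlog mu_sorted : mu size_mu / sorted <%R mu.
  move=> IH mu_uniq mu_rhp mu_lt0; rewrite -(size_sort <=%R).
  apply: IH; rewrite ?size_sort ?sort_uniq ?sort_lt_sorted //.
    by rewrite (perm_trans mu_rhp) // perm_map // perm_sym perm_sort.
  by move=> m; rewrite mem_sort; apply: mu_lt0.
move=> mu_uniq mu_rhp mu_lt0.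
have rhp_real z : z \in zeroes p -> 0 <= Re z -> z = (Re z)%:C /\ Re z \in mu.
  move=> zp z_ge0; have : z \in [seq z <- zeroes p | 0 <= Re z].
    by rewrite mem_filter z_ge0.
  by rewrite (perm_mem mu_rhp) => /mapP[x x_mu ->].
case size_muE : (size mu) => [|kappa] /=.
  split=> [|z zp]; first exact: monic_neq0.
  rewrite ltNge; apply/negP => /(rhp_real _ zp)[_].
  by rewrite (size0nil size_muE).
have mu_in i : (i < kappa.+1)%N -> mu`_i \in mu by rewrite -size_muE; apply: mem_nth.
have mu_gt0 i : (i < kappa.+1)%N -> 0 < mu`_i.
  by move=> /mu_in/(rhp_root mu_rhp)[].
have p_oppr i : (i < kappa.+1)%N -> p.[- mu`_i] != 0.
  by move=> /mu_in/mu_lt0; apply: contraTneq => ->; rewrite mulr0 ltxx.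
have parity i : (i < kappa.+1)%N ->
    odd (nb_real_zeroes p `](- mu`_i), +oo[) = ~~ odd (kappa - i).
  move=> lt_i; have := mu_lt0 _ (mu_in _ lt_i).
  rewrite deriv_mul_oppr_lt0 ?size_muE ?p_oppr // subSS oddD.
  by case: odd; case: odd.
exists mu; split=> //.
- exact: monic_neq0.
- by rewrite -size_muE size_mu andbT size_muE.
- exact/ltW/mu_gt0.
- by move=> i /andP[_ lt_i]; apply: p_oppr.
- by move=> _; apply: p_oppr.
- move=> i lt_i; have lt_mu : - mu`_i.+1 < - mu`_i.
    by rewrite ltrN2 (lt_sorted_ltn_nth 0 mu_sorted) ?inE ?size_muE //; lia.
  have /(congr1 odd) := nb_real_zeroes_split mp lt_mu (p_oppr _ (ltnW lt_i)).
  rewrite oddD !parity ?(ltnW lt_i) // (_ : kappa - i = (kappa - i.+1).+1)%N /=; last lia.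
  by case: odd; case: odd.
- have lt_mu : - mu`_0 < 0 by rewrite oppr_lt0 mu_gt0.
  have /(congr1 odd) := nb_real_zeroes_split mp lt_mu p0.
  rewrite oddD parity // (nb_real_zeroes_rhp mu_rhp) // subn0.
  rewrite (_ : count _ mu = kappa.+1).
    by rewrite /=; case: odd; case: odd.
  rewrite -size_muE; apply/eqP; rewrite -all_count; apply/allP => t /(rhp_root mu_rhp).
  by case.
- move=> x rx x_mu; have x_lt0 : x < 0.
    rewrite ltNge; apply: contra x_mu => x_ge0.
    by have [] := rhp_real x%:C; rewrite ?real_root_zeroes.
  have x_neq i : (i < kappa.+1)%N -> x != - mu`_i.
    by move=> /p_oppr; apply: contraNneq => <-; apply: rx.
  move=> betw x0; have x_mu0 : x < - mu`_0.
    by rewrite lt_neqAle x_neq //= leNgt; move: x0; rewrite in_itv /= x_lt0 andbT.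
  suff x_mui i : (i <= kappa)%N -> x < - mu`_i by apply: x_mui.
  elim: i => // i IH lt_i; rewrite lt_neqAle x_neq //= leNgt.
  by have := betw i lt_i; rewrite in_itv /= IH ?andbT // ltnW.
- have := odd_nb_real_zeroes_split mp (p_oppr kappa (ltnSn _)).
  by rewrite parity // subnn p_odd /=; case: odd.
- move=> z zp Imz; rewrite ltNge; apply: contra Imz => /(rhp_real _ zp)[-> _].
  by rewrite /= eqxx.
Qed.
End GeneralizedHurwitz.

(** * Routh's algorithm: from Hurwitz determinants to the entries *)

Section Routh.
Context {F : fieldType}.
Implicit Types (A B : nat -> F) (f g p : {poly F}).

(* For [f] and [g] the parts of [p] of the parities of [n] and [n - 1], the    *)
(* sequences [A i = a_(2 i)] and [B i = a_(2 i + 1)] give the Hurwitz matrix.  *)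
Definition hurwitz_mx A B j : 'M[F]_j :=
  \matrix_(r, s) if (r./2 <= s)%N then (if odd r then A else B) (s - r./2)%N else 0.

Definition ecoef f d i : F := if (i.*2 <= d)%N then f`_(d - i.*2) else 0.

Lemma eq_hurwitz_mx A A' B B' j : A =1 A' -> B =1 B' ->
  hurwitz_mx A B j = hurwitz_mx A' B' j.
Proof.
by move=> eA eB; apply/matrixP => r s; rewrite !mxE; case: odd; rewrite ?eA ?eB.
Qed.

(** One elimination step: subtracting from each odd row the normalized row above it factors the
    matrix as [L *m M] with [L] lower bidiagonal. The first column of [M] is the first unit vector,
    and deleting it with the first row leaves the Hurwitz matrix of the reduced pair. *)
Lemma det_hurwitz_mx_neq0 A B j : A 0%N = 1 -> B 0%N != 0 ->
  \det (hurwitz_mx A B j.+1) != 0 ->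
  \det (hurwitz_mx (fun i => B i / B 0%N)
                   (fun i => A i.+1 - B i.+1 / B 0%N) j) != 0.
Proof.
move=> A0 B0; pose Bn i := B i / B 0%N; pose D i := A i.+1 - Bn i.+1.
rewrite -/Bn -/D.
pose L : 'M[F]_j.+1 := \matrix_(r, s)
  if r == s then (if odd r then 1 else B 0%N)
  else if odd r && (r == s.+1 :> nat) then 1 else 0.
pose M : 'M[F]_j.+1 := \matrix_(r, s)
  if odd r then (if (r./2 < s)%N then D (s - r./2).-1 else 0)
  else (if (r./2 <= s)%N then Bn (s - r./2)%N else 0).
have -> : hurwitz_mx A B j.+1 = L *m M.
  apply/matrixP => r s; rewrite [RHS]mxE (bigD1 r) //= mxE [L r r]mxE eqxx [M r s]mxE.
  have [od_r|ev_r] := boolP (odd r); last first.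
    rewrite big1 ?addr0.
      by case: ifP => _; rewrite ?mulr0 // /Bn /= [RHS]mulrC divfK.
    by move=> t tr; rewrite mxE eq_sym (negPf tr) (negPf ev_r) mul0r.
  have lt_r : (r.-1 < j.+1)%N by apply: leq_ltn_trans (leq_pred _) (ltn_ord r).
  have r_gt0 : (0 < r)%N by case: (r : nat) od_r.
  rewrite (bigD1 (Ordinal lt_r)) /=; last by apply/eqP => /(congr1 val) /=; lia.
  rewrite big1 ?addr0; last first.
    move=> t /andP[tr tr']; rewrite mxE eq_sym (negPf tr) od_r ifN ?mul0r //.
    by apply: contra tr' => /eqP rE; apply/eqP/val_inj; rewrite /= rE.
  have rr : (r == r.-1 :> nat) = false by lia.
  rewrite !mxE -val_eqE /= prednK // eqxx od_r rr !mul1r.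
  have -> : odd r.-1 = false by have := od_r; lia.
  have -> : (r.-1./2 = r./2)%N by have := od_r; lia.
  case: ltngtP => [lt_rs|gt_rs|eq_rs]; rewrite ?addr0 //.
    have -> : (s - r./2 = (s - r./2).-1.+1)%N by lia.
    by rewrite /D /Bn subrK.
  by rewrite -eq_rs subnn A0 /Bn divff // add0r.
rewrite det_mulmx mulf_eq0 negb_or => /andP[_].
rewrite (expand_det_col M ord0) big_ord_recl big1 ?addr0; last first.
  move=> i _; rewrite mxE lift0 ltn0; case: ifP => [|ev_i]; first by rewrite mul0r.
  by rewrite ifN ?mul0r // -ltnNge half_gt0 ltnS lt0n; apply: contraFneq ev_i => ->.
rewrite mxE /= /Bn divff // mul1r /cofactor expr0 mul1r.
suff -> : row' ord0 (col' ord0 M) = hurwitz_mx Bn D j by [].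
apply/matrixP => r s; rewrite !mxE !lift0 /=.
have [od_r|ev_r] := boolP (odd r); rewrite /=.
  have -> : (uphalf r = r./2.+1)%N by rewrite uphalf_half od_r.
  by rewrite ltnS subSS.
have -> : (uphalf r = r./2)%N by rewrite uphalf_half (negPf ev_r).
by rewrite ltnS; case: ifP => // le_rs; rewrite subSn.
Qed.

(** Division of [f] by the normalized [g] undoes one step of the recursion: the divisor has to be
    the next polynomial, and the remainder the next tail. The determinant of order 1 is the pivot,
    the leading coefficient of [g]; those of higher order pass to the reduced pair. *)
Lemma routh_exists k f g : f \is monic -> size f = k.+2 -> (size g <= k.+1)%N ->
  (forall j, odd (k.+1 + j) -> f`_j = 0) -> (forall j, odd (k + j) -> g`_j = 0) ->
  (forall j, (1 <= j <= k.+1)%N ->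
     \det (hurwitz_mx (ecoef f k.+1) (ecoef g k) j) != 0) ->
  exists c : nat -> F,
    [/\ forall j, (j <= k)%N -> c j != 0, schq c k.+1 = f & c k *: schq c k = g].
Proof.
elim: k f g => [|k IH] f g mf sf sg odd_f odd_g det_neq0.
  have := det_neq0 1%N isT; rewrite det_mx11 mxE /= /ecoef /= subn0 => g0.
  have gE := size1_polyC sg; exists (fun => g`_0); split=> //.
    apply/polyP => j; rewrite coefX; case: j => [|[|j]].
    - by rewrite odd_f.
    - by have := monicP mf; rewrite lead_coefE sf.
    - by rewrite nth_default // sf.
  by rewrite [RHS]gE -[RHS]alg_polyC.
have f1 : f`_k.+2 = 1 by have := monicP mf; rewrite lead_coefE sf.
have B0 : g`_k.+1 != 0.
  by have := det_neq0 1%N isT; rewrite det_mx11 mxE /= /ecoef /= subn0.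
pose g' := (g`_k.+1)^-1 *: g; pose h := f - 'X * g'.
have g'1 : g'`_k.+1 = 1 by rewrite coefZ mulVf.
have sg' : size g' = k.+2.
  rewrite size_scale ?invr_eq0 //; apply/anti_leq; rewrite sg ltnNge.
  by apply: contra B0 => /leq_sizeP/(_ _ (leqnn _))->.
have mg' : g' \is monic by rewrite monicE lead_coefE sg' g'1.
have odd_g' j : odd (k.+1 + j) -> g'`_j = 0.
  by move=> /odd_g gj; rewrite coefZ gj mulr0.
have hE j : h`_j = f`_j - (if j is i.+1 then g'`_i else 0).
  by rewrite coefB coefXM; case: j.
have odd_h j : odd (k + j) -> h`_j = 0.
  move=> od_j; rewrite hE odd_f ?sub0r; last by move: od_j; rewrite !addSn /= negbK.
  case: j od_j => [|j] od_j; rewrite ?oppr0 // odd_g' ?oppr0 //.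
  by move: od_j; rewrite addnS.
(* The leading terms cancel and parity removes the next coefficient, so the degree drops by at least
   two. *)
have sh : (size h <= k.+1)%N.
  apply/leq_sizeP => j le_kj; have [lt_j|] := ltnP k.+2 j.
    rewrite hE nth_default ?sf //; case: j lt_j {le_kj} => // j lt_j.
    by rewrite nth_default ?subrr // sg'.
  rewrite leq_eqVlt => /predU1P[->|lt_j]; first by rewrite hE f1 g'1 subrr.
  by apply: odd_h; rewrite (_ : j = k.+1) ?addnS ?addnn /= ?odd_double //; lia.
have [j /andP[j_gt0 le_j]|c' [c'_neq0 q1 q0]] := IH g' h mg' sg' sh odd_g' odd_h.
  have e0 : ecoef f k.+2 0%N = 1 by rewrite /ecoef /= subn0.
  have e1 : ecoef g k.+1 0%N != 0 by rewrite /ecoef /= subn0.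
  have := det_hurwitz_mx_neq0 e0 e1 (det_neq0 j.+1 le_j).
  rewrite (@eq_hurwitz_mx _ (ecoef g' k.+1) _ (ecoef h k)) // => i.
    rewrite /ecoef /= subn0; case: ifP => _; last by rewrite mul0r.
    by rewrite coefZ mulrC.
  rewrite /ecoef /= subn0 doubleS !ltnS; case: ifP => le_ik; last first.
    by rewrite ifN ?mul0r ?subrr //; lia.
  rewrite hE !subSS; case: ltnP => [lt_ik|ge_ik].
    have -> : (k - i.*2 = (k - (i.*2).+1).+1)%N by lia.
    by rewrite coefZ mulrC.
  by rewrite (_ : k - i.*2 = 0)%N ?mul0r; last lia.
pose c j := if j == k.+1 then g`_k.+1 else c' j.
have cc' j : (j <= k)%N -> c j = c' j by move=> le_j; rewrite /c ifN //; lia.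
have ck : schq c k.+1 = g' by rewrite (@eq_schq _ _ c') // => j /= lt_j; apply/cc'/ltnW.
exists c; split.
- by move=> j; rewrite leq_eqVlt /c; case: eqP => //= _ /c'_neq0.
- rewrite schqSS ck cc' // (@eq_schq _ _ c').
    by rewrite q0 /h addrC subrK.
  by move=> j lt_j; apply: cc'; lia.
- by rewrite ck {1}/c eqxx /g' scalerA mulfV // scale1r.
Qed.

Lemma schp_exists N p : p \is monic -> size p = N.+2 ->
  (forall j, (1 <= j <= N.+1)%N -> hurwitz_det p j != 0) ->
  exists2 c : nat -> F, forall j, (j <= N)%N -> c j != 0 & schp c N = p.
Proof.
move=> mp sp det_neq0.
(* [f] collects the exponents of the parity of the degree [N.+1], [g] the others; they are to become
   [schq c N.+1] and [c N *: schq c N]. *)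
pose f := \poly_(j < N.+2) (if odd (N + j) then p`_j else 0).
pose g := \poly_(j < N.+2) (if odd (N + j) then 0 else p`_j).
have fE j : f`_j = if odd (N + j) then p`_j else 0.
  by rewrite coef_poly; case: ltnP => // le_j; rewrite nth_default ?sp //; case: ifP.
have gE j : g`_j = if odd (N + j) then 0 else p`_j.
  by rewrite coef_poly; case: ltnP => // le_j; rewrite nth_default ?sp //; case: ifP.
have f1 : f`_N.+1 = 1.
  by rewrite fE addnS addnn /= odd_double; have := monicP mp; rewrite lead_coefE sp.
have sf : size f = N.+2.
  by apply: size_poly_eq; have := f1; rewrite fE => ->; apply: oner_neq0.
have p_fg : p = f + g.
  by apply/polyP => j; rewrite coefD fE gE; case: ifP; rewrite ?addr0 ?add0r.
have [|||||j /andP[j_gt0 le_j]|c [c_neq0 q1 q0]] := @routh_exists N f g.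
- by rewrite monicE lead_coefE sf f1.
- exact: sf.
- apply/leq_sizeP => j; rewrite leq_eqVlt => /predU1P[<-|lt_j].
    by rewrite gE addnS addnn /= odd_double.
  by rewrite gE nth_default ?sp //; case: ifP.
- by move=> j; rewrite fE addSn /= => /negPf->.
- by move=> j oj; rewrite gE oj.
- have := det_neq0 j; rewrite j_gt0 le_j => /(_ isT).
  rewrite /hurwitz_det.
  rewrite (_ : \matrix_(r, s) _ = hurwitz_mx (ecoef f N.+1) (ecoef g N) j) //.
  apply/matrixP => r s; rewrite !mxE /ecoef /=.
  have := odd_double_half r; case: odd => /=; set i := r./2 => rE.
    rewrite -rE; case: leqP => [le_is|lt_si].
      rewrite (_ : _ - _ = ((s - i).*2)%:Z); last by lia.
      rewrite /hurwitz_coef sp /=; case: leqP => // le_N.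
      rewrite fE (_ : odd _ = true) //; lia.
    by rewrite (_ : _ - _ = Negz (i - s).*2.-1); last lia.
  rewrite -rE; case: leqP => [le_is|lt_si].
    rewrite (_ : _ - _ = ((s - i).*2.+1)%:Z); last by lia.
    rewrite /hurwitz_coef sp /= ltnS; case: leqP => // le_N.
    by rewrite gE subSS (_ : odd _ = false) //; lia.
  by rewrite (_ : _ - _ = Negz (i - s).-1.*2); last lia.
by exists c => //; rewrite /schp q1 q0.
Qed.
End Routh.

(** * Transfer to real entries through the complex numbers *)

Section SchwarzReal.
Context {R : rcfType} {l : nat} (b : (2 * l).+1.-tuple R).
Hypothesis b_neq0 : forall k, (k <= 2 * l)%N -> b`_k != 0.
Local Notation toC := (real_complex R).
Local Notation Re := complex.Re.
Local Notation Im := complex.Im.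
Local Notation N := (2 * l)%N.
Local Notation c := (@rev_entries N R b).
Local Notation p := (schp c N).
Local Notation rhp_zeroes mu :=
  (perm_eq [seq z <- zeroes p | 0 <= Re z] [seq x%:C | x <- mu]).
Let bC := map_tuple toC b.
Local Notation pC := (schp (@rev_entries N R[i] bC) N).

Let N_even : ~~ odd N. Proof. by rewrite oddM. Qed.

Let bCE k : bC`_k = toC b`_k.
Proof.
have [lt_k|le_k] := ltnP k (size b); first by rewrite (nth_map 0).
by rewrite !nth_default ?size_map ?rmorph0.
Qed.

Let bC_real k : bC`_k \is Num.real.
Proof. by rewrite bCE complex_real. Qed.

Let bC_neq0 k : (k <= N)%N -> bC`_k != 0.
Proof. by move=> le_k; rewrite bCE fmorph_eq0 b_neq0. Qed.

Let pCE : map_poly toC p = pC.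
Proof. by rewrite map_schp; apply: eq_schp => j _; rewrite /rev_entries bCE. Qed.

Let schwCE k : schw bC k = toC (schw b k).
Proof. by rewrite /schw rmorph_prod; apply: eq_bigr => i _; rewrite bCE. Qed.

Let deriv_mulCE x : pC^`().[x%:C] *
    pC.[- x%:C] = toC (p^`().[x] * p.[- x]).
Proof. by rewrite -pCE deriv_map -rmorphN !horner_map rmorphM. Qed.

Lemma schw_real_neq0 k : (k <= N)%N -> schw b k != 0.
Proof.
by move=> le_k; apply/prodf_neq0 => i _; apply: b_neq0; have := ltn_ord i; lia.
Qed.

(** The odd polynomial q_{N+1} vanishes at 0, so q_N does not, and p(0) = b_0 q_N(0). *)
Lemma schp0_neq0 : p.[0] != 0.
Proof.
have q1 : (schq c N.+1).[0] = 0.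
  have := @schqN_odd _ c N.+1 0 N_even.
  by rewrite oppr0 => /eqP; rewrite -subr_eq0 opprK -mulr2n mulrn_eq0 => /eqP.
rewrite hornerD hornerZ q1 add0r mulf_neq0 //.
  by rewrite /rev_entries subnn b_neq0.
by apply: schq_coprime q1 => j lt_j; apply/b_neq0/leq_subr.
Qed.

Lemma card_neg_even_schw :
  #|[set k : 'I_N.+1 | ~~ odd k & (schw b k < 0)%R]| = schwarz_neg_count l b.
Proof.
pose f (i : 'I_l.+1) : 'I_N.+1 := inord (2 * i).
have fE i : f i = (2 * i)%N :> nat.
  by rewrite inordK // ltnS leq_mul2l /= -ltnS ltn_ord.
have f_inj : injective f.
  move=> i j /(congr1 val) /=; rewrite !fE => /eqP.
  by rewrite eqn_mul2l => /eqP/val_inj.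
rewrite /schwarz_neg_count -(card_imset _ f_inj); apply: eq_card => k.
rewrite inE; apply/andP/imsetP => [[ev_k lt0]|[i + ->]]; last first.
  by rewrite inE /schw fE oddM.
have lt_k : (k./2 < l.+1)%N by have := ltn_ord k; lia.
exists (Ordinal lt_k); last by apply: ord_inj; rewrite fE /=; lia.
by rewrite inE /= (_ : 2 * k./2 = k)%N //; lia.
Qed.

(** The bounds #|S| <= size mu <= #|E| together with E included in S force E = S: every negative
    weight has even index. *)
Lemma schwarz_inertia (mu : seq R) : uniq mu -> rhp_zeroes mu ->
  {in mu, forall m, 0 < m /\ p^`().[m] * p.[- m] < 0} ->
  size mu = schwarz_neg_count l b /\
  (forall k : nat, (k <= N)%N -> odd k -> 0 < schw b k).
Proof.
move=> mu_uniq mu_rhp mu_lt0; have mp := schp_monic c N.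
pose S := [set k : 'I_N.+1 | (schw b k < 0)%R].
pose E := [set k : 'I_N.+1 | ~~ odd k & (schw b k < 0)%R].
have le_mu : (#|S| <= size mu)%N.
  rewrite -(size_map toC); apply: leq_trans (_ : #|S| <= _)%N _; first exact: leqnn.
  have -> : S = [set k : 'I_N.+1 | (schw bC k < 0)%R].
    by apply/setP => k; rewrite !inE schwCE -(ltcR _ 0).
  apply: (@neg_schw_le _ _ bC bC_real [seq z <- zeroes p | Re z < 0]).
    rewrite -pCE zeroesE // -(perm_big _ mu_rhp) /= -big_cat /=.
    rewrite -(perm_big _ (permEl (perm_filterC (fun z => Re z < 0) _))) /=.
    by congr bigop; congr (_ ++ _); apply: eq_filter => z; rewrite /= -leNgt.
  move=> z; rewrite mem_filter => /andP[Re_lt0 _].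
  by rewrite addcJ pmulr_rlt0 ?ltr0n // ltcR.
have le_E : (size mu <= #|E|)%N.
  rewrite -(size_map toC).
  have -> : E = [set k : 'I_N.+1 | ~~ odd k & (schw bC k < 0)%R].
    by apply/setP => k; rewrite !inE schwCE -(ltcR _ 0).
  apply: size_le_neg_even_schw => //; first by rewrite map_inj_uniq //; apply: complexI.
  move=> z /mapP[m m_mu ->]; have [m_gt0 lt0] := mu_lt0 _ m_mu.
  have [/rootP rm _] := rhp_root mp schp0_neq0 mu_rhp m_mu.
  by rewrite deriv_mulCE -pCE horner_map /= rm (ltcR 0) (ltcR _ 0).
have sub_ES : E \subset S by apply/subsetP => k; rewrite !inE => /andP[].
have ES : E = S by apply/eqP; rewrite eqEcard sub_ES (leq_trans le_mu).
split.
  by apply/anti_leq; rewrite -card_neg_even_schw le_E /= -/E ES.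
move=> k le_k od_k; rewrite lt_def schw_real_neq0 //= leNgt; apply/negP => lt0.
have : Ordinal (le_k : (k < N.+1)%N) \in S by rewrite inE.
by rewrite -ES inE /= od_k.
Qed.

Lemma odd_schw_gt0_rhp :
  (forall k : nat, (k <= N)%N -> odd k -> 0 < schw b k) ->
  exists mu : seq R, [/\ uniq mu, rhp_zeroes mu &
    {in mu, forall m, 0 < m /\ p^`().[m] * p.[- m] < 0}].
Proof.
move=> odd_gt0; have mp := schp_monic c N.
have rhp z : z \in zeroes p -> 0 <= Re z ->
    [/\ z = (Re z)%:C, 0 < Re z & p^`().[Re z] * p.[- Re z] < 0].
  rewrite root_zeroes // pCE => /rootP pz z_ge0.
  have [||z_gt0 lt0] := schwarz_root_rhp bC_real bC_neq0 N_even _ pz.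
  - by move=> k le_k od_k; rewrite schwCE (ltcR 0) odd_gt0.
  - by rewrite addcJ mulr_ge0 ?ler0n // ler0c.
  have zE : z = (Re z)%:C by apply/esym/RRe_real/gtr0_real.
  by split=> //; [rewrite -(ltcR 0) -zE | rewrite -(ltcR _ 0) -deriv_mulCE -zE].
exists [seq Re z | z <- zeroes p & 0 <= Re z].
have mapK : [seq x%:C | x <- [seq Re z | z <- zeroes p & 0 <= Re z]]
    = [seq z <- zeroes p | 0 <= Re z].
  rewrite -map_comp -[RHS]map_id; apply/eq_in_map => z.
  by rewrite mem_filter => /andP[z_ge0 zp] /=; have [<-] := rhp z zp z_ge0.
split; rewrite ?mapK //; last first.
  move=> m /mapP[z]; rewrite mem_filter => /andP[z_ge0 zp] ->.
  by have [] := rhp z zp z_ge0.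
apply: (@map_uniq _ _ toC); rewrite mapK; apply: count_mem_uniq => z.
have [z_in|z_notin] := boolP (z \in _); last by apply/count_memPn.
move: (z_in); rewrite mem_filter => /andP[z_ge0 zp].
have [zE _ lt0] := rhp z zp z_ge0.
rewrite count_filter (@eq_count _ _ (pred1 z)); last first.
  by move=> t /=; have [->|//] := eqVneq t z.
rewrite zE; apply/eqP; rewrite -deriv_zeroes_simple //.
  by apply: contraTneq lt0 => ->; rewrite mul0r ltxx.
by rewrite -real_root_zeroes // -zE.
Qed.
End SchwarzReal.

(** * Positive pairs and the weights of odd index *)

Section PairsPos.
Context {R : realDomainType} {N : nat} (b : N.+1.-tuple R).

Lemma schw_odd_step j : schw b j.*2.+1 =
  (if j is j'.+1 then schw b j'.*2.+1 else 1) * (b`_(2 * j) * b`_(2 * j).+1).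
Proof.
rewrite mul2n mulrA /schw big_ord_recr /=; congr (_ * _).
by case: j => [|j]; [rewrite big_ord1 mul1r | rewrite doubleS big_ord_recr].
Qed.

(** A weight of odd index is the product of the pairs up to it, and each pair is the quotient of two
    consecutive such weights. *)
Lemma schwarz_pairs_posP l : (2 * l = N)%N ->
  schwarz_pairs_pos l b <->
  (forall k : nat, (k <= N)%N -> odd k -> 0 < schw b k).
Proof.
move=> NE; split=> [pairs k le_k od_k|odd_gt0 j lt_j].
  have [j kE] : exists j, k = j.*2.+1 by exists k./2; lia.
  rewrite {}kE {od_k} in le_k *; elim: j le_k => [|j IH] le_j.
    by rewrite schw_odd_step mul1r; apply: pairs; lia.
  rewrite schw_odd_step pmulr_rgt0; first by apply: pairs; lia.
  by apply: IH; lia.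
have : 0 < schw b j.*2.+1 by apply: odd_gt0; lia.
rewrite schw_odd_step pmulr_rgt0 //; case: j lt_j => // j lt_j.
by apply: odd_gt0; lia.
Qed.
End PairsPos.

Theorem theorem5p2 (R : realType) (l n : nat) (hn : n = (2 * l + 1)%N) :
  (* direct problem *)
  (forall b : n.-tuple R,
     (forall k : nat, (k < n)%N -> b`_k != 0) ->
     (gen_hurwitz1 (char_poly (schwarz b)) <-> schwarz_pairs_pos l b)
     /\ (gen_hurwitz1 (char_poly (schwarz b)) ->
         forall kappa : nat, gen_hurwitz1_order (char_poly (schwarz b)) kappa ->
           kappa = schwarz_neg_count l b))
  /\
  (* inverse problem *)
  (forall (lam : n.-tuple R[i]) (p : {poly R}) (kappa : nat),
     map_poly (real_complex R) p = \prod_(k < n) ('X - (tnth lam k)%:P) ->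
     gen_hurwitz1_order p kappa ->
     (forall j : nat, (1 <= j <= n)%N -> hurwitz_det p j != 0) ->
     exists! b : n.-tuple R,
       [/\ forall k : nat, (k < n)%N -> b`_k != 0,
           schwarz_pairs_pos l b,
           schwarz_neg_count l b = kappa
         & perm_eq (spectrum (schwarz b)) lam]).
Proof.
rewrite addn1 in hn; subst n.
have order_inertia (b : (2 * l).+1.-tuple R) kappa :
    (forall k : nat, (k < (2 * l).+1)%N -> b`_k != 0) ->
    gen_hurwitz1_order (char_poly (schwarz b)) kappa ->
    kappa = schwarz_neg_count l b /\ schwarz_pairs_pos l b.
  move=> b_neq0; rewrite char_poly_schwarz => /gen_hurwitz1_order_sign[].
  - exact: schp_monic.
  - by rewrite size_schp /= oddM.
  - exact: schp0_neq0.
  move=> mu [<- mu_uniq mu_rhp mu_lt0].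
  have [-> odd_gt0] := schwarz_inertia b_neq0 mu_uniq mu_rhp mu_lt0.
  by split=> //; apply/(schwarz_pairs_posP b erefl).
split=> [b b_neq0|lam p kappa p_lam p_order det_neq0].
  split; last by move=> _ kappa /(order_inertia b kappa b_neq0)[].
  split=> [[kappa /(order_inertia b kappa b_neq0)[]] // | pairs].
  have /(odd_schw_gt0_rhp b_neq0)[mu [mu_uniq mu_rhp mu_lt0]] :=
    (schwarz_pairs_posP b erefl).1 pairs.
  exists (size mu); rewrite char_poly_schwarz.
  apply: sign_gen_hurwitz1_order => //.
  - exact: schp_monic.
  - by rewrite size_schp /= oddM.
  - exact: schp0_neq0.
  - have [-> _] := schwarz_inertia b_neq0 mu_uniq mu_rhp mu_lt0.
    (* The order counts negative terms among [l.+1] products, and [l.+1] is exactly the bound (n +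
       1) / 2. *)
    apply: leq_trans (max_card _) _; rewrite card_ord size_schp /=.
    by rewrite addn1 -addn2 -mulnSr mulKn.
  - by move=> m /mu_lt0[].
have prod_lam : \prod_(k < (2 * l).+1) ('X - (tnth lam k)%:P) =
    \prod_(z <- lam) ('X - z%:P) by rewrite big_tuple.
rewrite prod_lam in p_lam.
have mp : p \is monic.
  by rewrite -(map_monic (real_complex R)) p_lam monic_prod_XsubC.
have sp : size p = (2 * l).+2.
  by rewrite -(size_map_poly (real_complex R)) p_lam size_prod_XsubC size_tuple.
have spectrumE (b : (2 * l).+1.-tuple R) :
    perm_eq (spectrum (schwarz b)) lam <-> char_poly (schwarz b) = p.
  split=> [/(perm_big _) lamE|bp]; last by rewrite /spectrum bp perm_zeroes.
  apply: (map_poly_inj (real_complex R)).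
  by rewrite p_lam -lamE -zeroesE // char_poly_monic.
have [c c_neq0 c_p] := schp_exists mp sp det_neq0.
pose b := [tuple c (2 * l - i)%N | i < (2 * l).+1].
have bE k : (k <= 2 * l)%N -> b`_k = c (2 * l - k)%N.
  move=> le_k; rewrite -(tnth_nth 0 b (Ordinal (le_k : (k < (2 * l).+1)%N))).
  by rewrite tnth_mktuple.
have b_neq0 k : (k < (2 * l).+1)%N -> b`_k != 0.
  by move=> le_k; rewrite bE // c_neq0 // leq_subr.
have b_p : char_poly (schwarz b) = p.
  rewrite char_poly_schwarz -c_p; apply: eq_schp => j le_j.
  by rewrite /rev_entries bE ?leq_subr // subKn.
(* The direct part, applied to the matrix just built, gives the positive pairs and the count. *)
have [] := order_inertia b kappa b_neq0; first by rewrite b_p.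
move=> kappaE pairs; exists b; split; first by split=> //; apply/spectrumE.
move=> b' [b'_neq0 _ _ /spectrumE b'_p]; apply: eq_from_tnth => i.
have := @schp_inj _ (@rev_entries (2 * l) R b) (@rev_entries (2 * l) R b') (2 * l).
rewrite -!char_poly_schwarz b_p b'_p => eq_b.
have le_i : (i <= 2 * l)%N by rewrite -ltnS ltn_ord.
have := eq_b _ erefl (2 * l - i)%N (leq_subr _ _).
rewrite /rev_entries !subKn // !(tnth_nth 0); apply => j le_j.
by apply/b_neq0/leq_subr.
Qed.
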